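(* Let $\Gamma_1,\Gamma_2\subset\mathbb{C}$ be quasilines, and assume that $\Gamma_2$ is an asymptotically conformal quasiline. Let $h\colon\Gamma_1\to\Gamma_2$ be a uniformly continuous quasisymmetric homeomorphism. If $h$ is equidistant weakly asymptotically symmetric (EWAS), then $h$ is asymptotically symmetric (AS). Consequently, for such $h$ the conditions EWAS, WAS (weakly asymptotically symmetric), and AS are equivalent.
   Context: Let $X,Y$ be metric spaces with distances written $|x_1-x_2|$; subsets of $\mathbb{C}$ carry the Euclidean metric. An embedding $h\colon X\to Y$ (homeomorphism onto its image) is quasisymmetric if there is a homeomorphism $\eta\colon[0,\infty)\to[0,\infty)$ such that for any three distinct points $a,b,x\in X$ and $t\ge 0$, $\frac{|a-x|}{|b-x|}\le t$ implies $\frac{|h(a)-h(x)|}{|h(b)-h(x)|}\le\eta(t)$. A quasiline is a set $\Gamma\subset\mathbb{C}$ that is the image $f(\mathbb{R})$ of a quasisymmetric embedding $f\colon\mathbb{R}\to\mathbb{C}$ (together with $\infty$ it is a Jordan curve in the Riemann sphere). For $a,b\in\Gamma$, $\Gamma[a,b]$ denotes the bounded subarc of $\Gamma$ joining them. A quasiline $\Gamma$ is asymptotically conformal if $$\omega_\Gamma(r):=\sup_{a,b\in\Gamma,\ 0<|a-b|\le r}\ \max_{w\in\Gamma[a,b]}\left(\frac{|a-w|+|w-b|}{|a-b|}-1\right)\to0\qquad(r\to0).$$ $h$ is asymptotically symmetric (AS) if for every $\varepsilon>0$ and every $t>0$ there exists $\delta>0$ such that for all distinct $a,b,x\in X$ with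 $\operatorname{diam}\{a,b,x\}\le\delta$: $\frac{|a-x|}{|b-x|}\le t$ implies $\frac{|h(a)-h(x)|}{|h(b)-h(x)|}\le(1+\varepsilon)t$. $h$ is weakly asymptotically symmetric (WAS) if this is required only for $t=1$ (for every $\varepsilon>0$). For $r>0$ put $$H_h^{\mathrm{eq}}(r)=\sup\left\{\max\left(\tfrac{|h(a)-h(x)|}{|h(b)-h(x)|},\tfrac{|h(b)-h(x)|}{|h(a)-h(x)|}\right): a,b,x\in X,\ |a-x|=|b-x|,\ 0<\operatorname{diam}\{a,b,x\}\le r\right\}.$$ $h$ is equidistant weakly asymptotically symmetric (EWAS) if $H_h^{\mathrm{eq}}(r)\to1$ as $r\to0$. *)

(* Defs.v *)
From Stdlib Require Import Reals Lra Classical_Prop.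
From Coquelicot Require Import Coquelicot.
Open Scope R_scope.

Set Implicit Arguments.

(** Metric spaces are Stdlib's [Metric_Space]; the real line is [R_met]. *)

Arguments Base : clear implicits.
Arguments dist {_} _ _.

Lemma Cdist_refl (z w : C) : Cmod (z - w)%C = 0 <-> z = w.
Proof.
split.
- intros H; apply Cmod_eq_0 in H.
  replace z with ((z - w) + w)%C by ring; rewrite H; ring.
- intros ->; replace (w - w)%C with (RtoC 0) by ring; apply Cmod_0.
Qed.

Lemma Cdist_sym (z w : C) : Cmod (z - w)%C = Cmod (w - z)%C.
Proof. rewrite <- Cmod_opp; f_equal; ring. Qed.

Lemma Cdist_tri (z w v : C) :
  Cmod (z - w)%C <= Cmod (z - v)%C + Cmod (v - w)%C.
Proof.
replace (z - w)%C with ((z - v) + (v - w))%C by ring; apply Cmod_triangle.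
Qed.

Definition C_met : Metric_Space :=
  Build_Metric_Space C (fun z w => Cmod (z - w)%C)
    (fun z w => Rle_ge _ _ (Cmod_ge_0 _)) Cdist_sym Cdist_refl Cdist_tri.

Lemma sub_dist_refl (M : Metric_Space) (A : Base M -> Prop) (x y : sig A) :
  dist (proj1_sig x) (proj1_sig y) = 0 <-> x = y.
Proof.
destruct x as [x Ax], y as [y Ay]; simpl; rewrite dist_refl; split.
- intros e; subst y; f_equal; apply proof_irrelevance.
- intros e; exact (f_equal (@proj1_sig _ _) e).
Qed.

Definition subspace (M : Metric_Space) (A : Base M -> Prop) : Metric_Space :=
  Build_Metric_Space (sig A)
    (fun x y => dist (proj1_sig x) (proj1_sig y))
    (fun x y => dist_pos M _ _) (fun x y => dist_sym M _ _)
    (@sub_dist_refl M A) (fun x y z => dist_tri M _ _ _).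

Definition continuous_map {X Y : Metric_Space}
    (f : Base X -> Base Y) : Prop :=
  forall (x : Base X) (eps : posreal), exists delta : posreal,
    forall y : Base X, dist y x < delta -> dist (f y) (f x) < eps.

Definition uniformly_continuous_map {X Y : Metric_Space}
    (f : Base X -> Base Y) : Prop :=
  forall eps : posreal, exists delta : posreal,
    forall x y : Base X, dist x y < delta -> dist (f x) (f y) < eps.

Definition range {X Y : Metric_Space} (f : Base X -> Base Y) (y : Base Y) : Prop :=
  exists x, f x = y.

Definition corestrict {X Y : Metric_Space} (f : Base X -> Base Y)
    (x : Base X) : Base (subspace Y (range f)) :=
  exist (range f) (f x) (ex_intro _ x eq_refl).

Definition diam3 {X : Metric_Space} (a b x : Base X) : R :=
  Rmax (dist a b) (Rmax (dist a x) (dist b x)).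

Definition distinct3 {X : Metric_Space} (a b x : Base X) : Prop :=
  a <> b /\ a <> x /\ b <> x.

Definition homeomorphism {X Y : Metric_Space}
    (f : Base X -> Base Y) : Prop :=
  continuous_map f /\
  exists g : Base Y -> Base X,
    continuous_map g /\
    (forall x, g (f x) = x) /\ (forall y, f (g y) = y).

Definition embedding {X Y : Metric_Space}
    (f : Base X -> Base Y) : Prop :=
  homeomorphism (corestrict f).

Definition half_line : Metric_Space := subspace R_met (fun t : R => 0 <= t).

Definition quasisymmetric {X Y : Metric_Space}
    (h : Base X -> Base Y) : Prop :=
  embedding h /\
  exists eta : Base half_line -> Base half_line,
    homeomorphism eta /\
    forall (a b x : Base X) (t : Base half_line),
      distinct3 a b x ->
      dist a x / dist b x <= proj1_sig t ->
      dist (h a) (h x) / dist (h b) (h x) <= proj1_sig (eta t).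

Definition quasiline (Gamma : Base C_met -> Prop) : Prop :=
  exists f : Base R_met -> Base C_met,
    quasisymmetric f /\
    forall z, Gamma z <-> range f z.

Definition unit_interval : Metric_Space :=
  subspace R_met (fun s : R => 0 <= s <= 1).

Definition I0 : Base unit_interval :=
  exist (fun s : R => 0 <= s <= 1) 0 (conj (Rle_refl 0) Rle_0_1).

Definition I1 : Base unit_interval :=
  exist (fun s : R => 0 <= s <= 1) 1 (conj Rle_0_1 (Rle_refl 1)).

(** [A] is a compact (hence bounded) arc with endpoints [a], [b] contained in
    [Gamma].  On a quasiline such an [A] is unique: it is [Gamma[a,b]]. *)
Definition is_subarc (Gamma : Base C_met -> Prop) (a b : Base C_met)
    (A : Base C_met -> Prop) : Prop :=
  (forall w, A w -> Gamma w) /\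
  exists g : Base unit_interval -> Base C_met,
    embedding g /\ g I0 = a /\ g I1 = b /\
    forall w, A w <-> range g w.

Definition is_max (E : R -> Prop) (m : R) : Prop :=
  E m /\ forall y, E y -> y <= m.

(** Suprema are taken in [Rbar], so they may be [p_infty].  (An empty supremum
    would be [m_infty]; on a quasiline the sets below are never empty.) *)
Definition omega (Gamma : Base C_met -> Prop) (r : R) : Rbar :=
  Lub_Rbar (fun m => exists (a b : Base C_met) (A : Base C_met -> Prop),
    Gamma a /\ Gamma b /\ 0 < dist a b <= r /\ is_subarc Gamma a b A /\
    is_max (fun v => exists w, A w /\
              v = (dist a w + dist w b) / dist a b - 1) m).

(** [F r -> l] as [r -> 0], [r > 0]; in particular [F r] is eventually
    finite.  (Applying [real] to [F r] would instead send [p_infty] to 0.) *)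
Definition tends_to_at_0 (F : R -> Rbar) (l : R) : Prop :=
  forall eps : posreal, at_right 0 (fun r =>
    Rbar_lt (l - eps) (F r) /\ Rbar_lt (F r) (l + eps)).

Definition asymptotically_conformal (Gamma : Base C_met -> Prop) : Prop :=
  tends_to_at_0 (omega Gamma) 0.

Definition asymptotically_symmetric_at {X Y : Metric_Space} (t : R)
    (h : Base X -> Base Y) : Prop :=
  forall eps : R, 0 < eps -> exists delta : R, 0 < delta /\
    forall a b x : Base X, distinct3 a b x -> diam3 a b x <= delta ->
      dist a x / dist b x <= t ->
      dist (h a) (h x) / dist (h b) (h x) <= (1 + eps) * t.

Definition AS {X Y : Metric_Space} (h : Base X -> Base Y) : Prop :=
  forall t : R, 0 < t -> asymptotically_symmetric_at t h.

Definition WAS {X Y : Metric_Space} (h : Base X -> Base Y) : Prop :=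
  asymptotically_symmetric_at 1 h.

Definition H_eq {X Y : Metric_Space} (h : Base X -> Base Y) (r : R) : Rbar :=
  Lub_Rbar (fun v => exists a b x : Base X,
    dist a x = dist b x /\ 0 < diam3 a b x <= r /\
    v = Rmax (dist (h a) (h x) / dist (h b) (h x))
             (dist (h b) (h x) / dist (h a) (h x))).

Definition EWAS {X Y : Metric_Space} (h : Base X -> Base Y) : Prop :=
  tends_to_at_0 (H_eq h) 1.

(* Main.v *)
Require Import Defs.
From Stdlib Require Import Reals Lra Lia Classical IndefiniteDescription.
From Coquelicot Require Import Coquelicot.
Open Scope R_scope.

(** The hard implication is EWAS => AS, by blow-up.  Parametrise [Gamma2] by the
    line and pull both metrics back, [gap] from [Gamma1] and [rho] from [Gamma2].
    Asymptotic conformality makes [rho] almost additive along the line at small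
    scales.  Walk along [Gamma1] with steps of constant [gap] [s]: by EWAS the
    [rho]-steps are almost equal, so [rho] is almost proportional to the index.
    By EWAS and quasisymmetry, in the limit [s -> 0] the rescaled walk becomes
    a planar sequence [p] with
    [|p (j + m) - p j| = |p (j + 2 m) - p (j + m)|] for all [j], [m], and
    [|p k| -> oo].  In the plane this is rigid: its turning angles have period 24,
    so [p (j + 24) = w p j + c] with [|w| = 1], and [w <> 1] would keep [p (24 k)]
    on a circle.  Hence [|p (24 k) - p 0| = k |p 24 - p 0|], that is, both metrics
    are asymptotically proportional to the index along every 24th point.  Placing
    [a] and [b] between such points of a walk that starts at [x] compares the
    [gap]-ratio with the [rho]-ratio. *)

(** * Planar sequences whose distances are reflected at every point *)

Lemma Cmod_sqr (z : C) : Cmod z * Cmod z = Re z * Re z + Im z * Im z.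
Proof.
unfold Cmod; rewrite sqrt_sqrt; [simpl; unfold Re, Im; ring | nra].
Qed.

Lemma periodic_mult (f : nat -> R) (q n : nat) :
  (forall j, f (q + j)%nat = f j) -> forall j, f (n * q + j)%nat = f j.
Proof.
intros Hf j; induction n as [|n IH]; [reflexivity|].
replace (S n * q + j)%nat with (q + (n * q + j))%nat by lia.
now rewrite Hf.
Qed.

(** Products of neighbours along [r * j + i] survive the shift by [q], so the ratio of shifted to
    unshifted value at one term is the inverse of the ratio at the term before; [e] is its own
    inverse. *)
Lemma common_sign (y : nat -> R) (e : R) (q r i : nat) :
  (forall j, y (q + (r * j + i))%nat * y (q + (r * S j + i))%nat
             = y (r * j + i)%nat * y (r * S j + i)%nat) ->
  (forall j, y (r * j + i)%nat <> 0) ->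
  y (q + i)%nat = e * y i -> e * e = 1 ->
  forall j, y (q + (r * j + i))%nat = e * y (r * j + i)%nat.
Proof.
intros Hprod Hnz H0 He j; induction j as [|j IH].
- now rewrite Nat.mul_0_r.
- specialize (Hprod j); rewrite IH in Hprod; pose proof (Hnz j).
  apply Rmult_eq_reg_l with (y (r * j + i)%nat); [|assumption].
  replace (y (r * j + i)%nat * (e * y (r * S j + i)%nat))
    with (e * (y (r * j + i)%nat * y (r * S j + i)%nat)) by ring.
  rewrite <- Hprod.
  transitivity (e * e * (y (r * j + i)%nat * y (q + (r * S j + i))%nat));
    [rewrite He|]; ring.
Qed.

Lemma sqr_eq_sign (u v : R) : u * u = v * v -> exists e, e * e = 1 /\ u = e * v.
Proof.
intros H; assert (H' : (u - v) * (u + v) = 0) by lra.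
apply Rmult_integral in H' as [H'|H']; [exists 1|exists (-1)]; split; lra.
Qed.

(* [x j] and [y j] are the real and imaginary parts of the quotient of two
   consecutive steps; the three hypotheses make [x], [Re (z z')] and
   [Re (z z' z'')] periodic with period 12 = lcm (2, 3, 4), which determines
   [y (j + 12) / y j] up to one global sign. *)
Lemma turning_periodic (a b : nat -> R) :
  (forall j, a j * a j + b j * b j = 1) ->
  (forall j, (a j + a (1 + j)%nat)^2 + (b j + b (1 + j)%nat)^2 =
     (a (2 + j)%nat + a (3 + j)%nat)^2 + (b (2 + j)%nat + b (3 + j)%nat)^2) ->
  (forall j, (a j + a (1 + j)%nat + a (2 + j)%nat)^2
           + (b j + b (1 + j)%nat + b (2 + j)%nat)^2 =
     (a (3 + j)%nat + a (4 + j)%nat + a (5 + j)%nat)^2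
     + (b (3 + j)%nat + b (4 + j)%nat + b (5 + j)%nat)^2) ->
  (forall j, (a j + a (1 + j)%nat + a (2 + j)%nat + a (3 + j)%nat)^2
           + (b j + b (1 + j)%nat + b (2 + j)%nat + b (3 + j)%nat)^2 =
     (a (4 + j)%nat + a (5 + j)%nat + a (6 + j)%nat + a (7 + j)%nat)^2
     + (b (4 + j)%nat + b (5 + j)%nat + b (6 + j)%nat + b (7 + j)%nat)^2) ->
  forall j,
    a (24 + j)%nat * a (25 + j)%nat + b (24 + j)%nat * b (25 + j)%nat
    = a j * a (1 + j)%nat + b j * b (1 + j)%nat /\
    a (24 + j)%nat * b (25 + j)%nat - b (24 + j)%nat * a (25 + j)%nat
    = a j * b (1 + j)%nat - b j * a (1 + j)%nat.
Proof.
intros N H2 H3 H4.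
(* For unit steps, [g i j] is the real part of the product of the [i] consecutive quotients from
   index [j] on. *)
set (g i j := a j * a (i + j)%nat + b j * b (i + j)%nat).
set (x := g 1%nat).
set (y j := a j * b (1 + j)%nat - b j * a (1 + j)%nat).
assert (X2 : forall j, x (2 + j)%nat = x j).
{ intros j; unfold x, g.
  pose proof (H2 j); pose proof (N j); pose proof (N (1 + j)%nat);
  pose proof (N (2 + j)%nat); pose proof (N (3 + j)%nat); simpl in *; lra. }
(* The squared modulus of a sum of three steps is 3 plus twice the sum in [T], which thus has period
   3; removing the 2-periodic terms leaves the common period 12. *)
assert (G2 : forall j, g 2%nat (12 + j)%nat = g 2%nat j).
{ assert (T : forall j, (fun j => x j + x (1 + j)%nat + g 2%nat j) (3 + j)%nat
      = (fun j => x j + x (1 + j)%nat + g 2%nat j) j).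
  { intros j; unfold x, g.
    pose proof (H3 j); pose proof (N j); pose proof (N (1 + j)%nat);
    pose proof (N (2 + j)%nat); pose proof (N (3 + j)%nat);
    pose proof (N (4 + j)%nat); pose proof (N (5 + j)%nat); simpl in *; lra. }
  intros j; pose proof (periodic_mult _ _ 4 T j) as T4.
  pose proof (periodic_mult _ _ 6 X2 j); pose proof (periodic_mult _ _ 6 X2 (1 + j)).
  simpl in *; lra. }
assert (G3 : forall j, g 3%nat (12 + j)%nat = g 3%nat j).
{ set (t j := x j + x (1 + j)%nat + x (2 + j)%nat
              + g 2%nat j + g 2%nat (1 + j)%nat + g 3%nat j).
  assert (T : forall j, t (4 + j)%nat = t j).
  { intros j; unfold t, x, g.
    pose proof (H4 j); pose proof (N j); pose proof (N (1 + j)%nat);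
    pose proof (N (2 + j)%nat); pose proof (N (3 + j)%nat);
    pose proof (N (4 + j)%nat); pose proof (N (5 + j)%nat);
    pose proof (N (6 + j)%nat); pose proof (N (7 + j)%nat); simpl in *; lra. }
  intros j; pose proof (periodic_mult _ _ 3 T j) as T4; unfold t in T4.
  pose proof (periodic_mult _ _ 6 X2 j); pose proof (periodic_mult _ _ 6 X2 (1 + j));
  pose proof (periodic_mult _ _ 6 X2 (2 + j)).
  pose proof (G2 j); pose proof (G2 (1 + j)%nat).
  simpl in *; lra. }
assert (X12 : forall j, x (12 + j)%nat = x j) by exact (periodic_mult _ _ 6 X2).
assert (XY : forall j, x j * x j + y j * y j = 1).
{ intros j; unfold x, y, g.
  transitivity ((a j * a j + b j * b j)
    * (a (1 + j)%nat * a (1 + j)%nat + b (1 + j)%nat * b (1 + j)%nat)); [ring|].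
  rewrite !N; ring. }
(* The real part of a product of two quotients determines the product of their imaginary parts. *)
assert (E2 : forall j, y j * y (1 + j)%nat = x j * x (1 + j)%nat - g 2%nat j).
{ intros j; transitivity (x j * x (1 + j)%nat
    - (a (1 + j)%nat * a (1 + j)%nat + b (1 + j)%nat * b (1 + j)%nat) * g 2%nat j).
  - unfold x, y, g; simpl; ring.
  - rewrite N; ring. }
(* A quotient without imaginary part is 1 or -1, so it can be cancelled from the product of three
   quotients; this links indices two apart. *)
assert (E3 : forall j, y (1 + j)%nat = 0 ->
  y j * y (2 + j)%nat = x j * x (2 + j)%nat - x (1 + j)%nat * g 3%nat j).
{ intros j Hj; pose proof (XY (1 + j)%nat) as Hx; rewrite Hj in Hx.
  assert (E : g 3%nat j = x j * x (1 + j)%nat * x (2 + j)%nat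
     - x j * y (1 + j)%nat * y (2 + j)%nat - y j * x (1 + j)%nat * y (2 + j)%nat
     - y j * y (1 + j)%nat * x (2 + j)%nat).
  { transitivity ((a (1 + j)%nat * a (1 + j)%nat + b (1 + j)%nat * b (1 + j)%nat)
      * (a (2 + j)%nat * a (2 + j)%nat + b (2 + j)%nat * b (2 + j)%nat) * g 3%nat j);
      [rewrite !N; ring | unfold x, y, g; simpl; ring]. }
  rewrite E, Hj.
  transitivity (x j * x (2 + j)%nat - (x (1 + j)%nat * x (1 + j)%nat)
     * (x j * x (2 + j)%nat - y j * y (2 + j)%nat)); [|ring].
  replace (x (1 + j)%nat * x (1 + j)%nat) with 1 by lra; ring. }
(* Since [x] has period 2, so has the square of [y]: whether [y] vanishes depends only on parity. *)
assert (Ysq : forall j, y (2 + j)%nat * y (2 + j)%nat = y j * y j).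
{ intros j; pose proof (XY j); pose proof (XY (2 + j)%nat) as H'.
  rewrite X2 in H'; lra. }
assert (Ysq' : forall n j, y (2 * n + j)%nat * y (2 * n + j)%nat = y j * y j).
{ intros n j; rewrite (Nat.mul_comm 2).
  exact (periodic_mult (fun j => y j * y j) 2 n Ysq j). }
assert (Z : forall n j, y j = 0 -> y (2 * n + j)%nat = 0).
{ intros n j Hj; pose proof (Ysq' n j) as H; rewrite Hj in H.
  assert (H0 : y (2 * n + j)%nat * y (2 * n + j)%nat = 0) by lra.
  apply Rmult_integral in H0; tauto. }
assert (NZ : forall n j, y j <> 0 -> y (2 * n + j)%nat <> 0).
{ intros n j Hj H0; apply Hj; pose proof (Ysq' n j) as H; rewrite H0 in H.
  assert (H1 : y j * y j = 0) by lra; apply Rmult_integral in H1; tauto. }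
assert (sign0 : forall i, exists e, e * e = 1 /\ y (12 + i)%nat = e * y i).
{ intros i; apply sqr_eq_sign; exact (Ysq' 6%nat i). }
assert (evenodd : forall j, exists n i, j = (2 * n + i)%nat /\ (i = 0 \/ i = 1)%nat).
{ intros j; exists (Nat.div2 j), (Nat.b2n (Nat.odd j)); split;
    [exact (Nat.div2_odd j) | destruct (Nat.odd j); simpl; auto]. }
(* If [y] vanishes on exactly one parity class, [E2] carries no information, and [E3] transports the
   sign along the other class. *)
assert (half : forall i i', (i = 0 /\ i' = 1 \/ i = 1 /\ i' = 0)%nat ->
  y i = 0 -> y i' <> 0 ->
  exists e, e * e = 1 /\ forall j, y (12 + j)%nat = e * y j).
{ intros i i' Hii Hi Hi'; destruct (sign0 i') as (e & He & H0).
  exists e; split; [assumption|].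
  assert (C : forall j, y (12 + (2 * j + i'))%nat = e * y (2 * j + i')%nat).
  { apply common_sign; [|intros n; now apply NZ|assumption|assumption].
    intros j.
    assert (V : y (1 + (2 * j + i'))%nat = 0).
    { replace (1 + (2 * j + i'))%nat with
        (2 * (j + i') + i)%nat by lia; now apply Z. }
    replace (12 + (2 * S j + i'))%nat with (2 + (12 + (2 * j + i')))%nat by lia.
    replace (2 * S j + i')%nat with (2 + (2 * j + i'))%nat by lia.
    rewrite !E3; [|assumption|].
    - replace (1 + (12 + (2 * j + i')))%nat with (12 + (1 + (2 * j + i')))%nat by lia.
      now rewrite !X2, !X12, G3.
    - exact (Z 6%nat _ V). }
  intros j; destruct (evenodd j) as (n & k & -> & Hk).
  destruct (Nat.eq_dec k i') as [->|Hne]; [apply C|].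
  replace k with i by lia.
  rewrite (Z n i Hi); replace (12 + (2 * n + i))%nat with (2 * (6 + n) + i)%nat by lia.
  rewrite (Z _ i Hi); ring. }
assert (main : exists e, e * e = 1 /\ forall j, y (12 + j)%nat = e * y j).
{ destruct (Req_dec (y 0%nat) 0) as [H0|H0], (Req_dec (y 1%nat) 0) as [H1|H1].
  - exists 1; split; [ring|]; intros j; destruct (evenodd j) as (n & k & -> & Hk).
    assert (Hy : y k = 0) by (destruct Hk; now subst k).
    rewrite (Z n k Hy); replace (12 + (2 * n + k))%nat with (2 * (6 + n) + k)%nat by lia.
    rewrite (Z _ k Hy); ring.
  - apply (half 0%nat 1%nat); auto.
  - apply (half 1%nat 0%nat); auto.
  (* Here [y] has no zero, and [E2] transports the sign from each index to the next. *)
  - destruct (sign0 0%nat) as (e & He & Hy0); exists e; split; [assumption|].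
    intros j; pose proof (common_sign y e 12 1 0) as C.
    replace j with (1 * j + 0)%nat by lia; apply C; [| |assumption|assumption].
    + intros k; replace (12 + (1 * S k + 0))%nat with (1 + (12 + (1 * k + 0)))%nat by lia.
      replace (1 * S k + 0)%nat with (1 + (1 * k + 0))%nat by lia.
      rewrite !E2.
      replace (1 + (12 + (1 * k + 0)))%nat with (12 + (1 + (1 * k + 0)))%nat by lia.
      now rewrite !X12, G2.
    + intros k; destruct (evenodd k) as (n & l & -> & Hl).
      replace (1 * (2 * n + l) + 0)%nat with (2 * n + l)%nat by lia.
      apply NZ; destruct Hl; now subst l. }
intros j; split.
- exact (periodic_mult _ _ 12 X2 j).
(* Two shifts by 12 multiply [y] by [e * e = 1]; this is why the period is 24 and not 12. *)
- destruct main as (e & He & Hy).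
  change (y (12 + (12 + j))%nat = y j); rewrite !Hy, <- Rmult_assoc, He; ring.
Qed.

(** Equal chords over 2, 3 and 4 steps feed [turning_periodic], so the shift by 24 acts as a rigid
    motion preserving orientation. The growth condition excludes a rotation: the vertices of a
    regular polygon, traversed repeatedly, satisfy the other two hypotheses. *)
Lemma equidistant_progression (p : nat -> C) :
  (forall j, Cmod (p (S j) - p j)%C = 1) ->
  (forall j m, Cmod (p (j + m)%nat - p j)%C = Cmod (p (j + m + m)%nat - p (j + m)%nat)%C) ->
  (forall B : R, exists k0, forall k, (k0 <= k)%nat -> B < Cmod (p k - p 0%nat)%C) ->
  forall k, Cmod (p (24 * k)%nat - p 0%nat)%C = INR k * Cmod (p 24%nat - p 0%nat)%C.
Proof.
intros N Hrel Hinf.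
set (u j := (p (S j) - p j)%C).
assert (HN : forall j, Re (u j) * Re (u j) + Im (u j) * Im (u j) = 1).
{ intros j; rewrite <- Cmod_sqr; unfold u; rewrite N; ring. }
assert (Hsq : forall j m,
  Cmod (p (j + m)%nat - p j)%C * Cmod (p (j + m)%nat - p j)%C =
  Cmod (p (j + m + m)%nat - p (j + m)%nat)%C * Cmod (p (j + m + m)%nat - p (j + m)%nat)%C)
  by (intros j m; now rewrite Hrel).
assert (T := turning_periodic (fun j => Re (u j)) (fun j => Im (u j)) HN).
assert (HT : forall j, (u (25 + j)%nat * Cconj (u (24 + j)%nat))%C
                       = (u (1 + j)%nat * Cconj (u j))%C).
{ intros j; destruct (T) with (j := j) as [HR HI].
  - clear j; intros j; pose proof (Hsq j 2%nat) as H; rewrite !Cmod_sqr in H.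
    replace (j + 2 + 2)%nat with (4 + j)%nat in H by lia.
    replace (j + 2)%nat with (2 + j)%nat in H by lia.
    unfold u; simpl in *; unfold Re, Im in *; simpl in *; lra.
  - clear j; intros j; pose proof (Hsq j 3%nat) as H; rewrite !Cmod_sqr in H.
    replace (j + 3 + 3)%nat with (6 + j)%nat in H by lia.
    replace (j + 3)%nat with (3 + j)%nat in H by lia.
    unfold u; simpl in *; unfold Re, Im in *; simpl in *; lra.
  - clear j; intros j; pose proof (Hsq j 4%nat) as H; rewrite !Cmod_sqr in H.
    replace (j + 4 + 4)%nat with (8 + j)%nat in H by lia.
    replace (j + 4)%nat with (4 + j)%nat in H by lia.
    unfold u; simpl in *; unfold Re, Im in *; simpl in *; lra.
  - apply injective_projections; unfold Cconj, Cmult; cbn [fst snd];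
      unfold Re, Im in *; lra. }
assert (Hconj : forall j, (Cconj (u j) * u j)%C = RtoC 1).
{ intros j; specialize (HN j); apply injective_projections;
    unfold Cconj, Cmult, Re, Im in *; cbn [fst snd RtoC]; lra. }
set (w := (u 24%nat * Cconj (u 0%nat))%C).
(* The relation holds at index 0 by the choice of [w], and equal quotients propagate it. *)
assert (Hu : forall j, u (24 + j)%nat = (w * u j)%C).
{ intros j; induction j as [|j IH].
  - unfold w; rewrite <- Cmult_assoc, Hconj; simpl; ring.
  - replace (24 + S j)%nat with (25 + j)%nat by lia.
    transitivity (u (25 + j)%nat * (Cconj (u (24 + j)%nat) * u (24 + j)%nat))%C.
    { rewrite Hconj; ring. }
    rewrite Cmult_assoc, HT, IH.
    transitivity (w * u (1 + j)%nat * (Cconj (u j) * u j))%C; [ring|].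
    rewrite Hconj; simpl; ring. }
assert (Hp : forall j, p (24 + j)%nat = (p 24%nat + w * (p j - p 0%nat))%C).
{ intros j; induction j as [|j IH]; [rewrite Nat.add_0_r; ring|].
  pose proof (Hu j) as H; unfold u in H.
  transitivity ((p (S (24 + j)) - p (24 + j)%nat) + p (24 + j)%nat)%C.
  { replace (24 + S j)%nat with (S (24 + j)) by lia; ring. }
  rewrite H, IH; ring. }
destruct (Ceq_dec w (RtoC 1)) as [Hw|Hw].
- intros k.
  assert (Hk : (p (24 * k)%nat - p 0%nat)%C = (RtoC (INR k) * (p 24%nat - p 0%nat))%C).
  { induction k as [|k IH]; [simpl; ring|].
    replace (24 * S k)%nat with (24 + 24 * k)%nat by lia.
    rewrite Hp, IH, Hw, S_INR, RtoC_plus; ring. }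
  rewrite Hk, Cmod_mult, Cmod_R, Rabs_pos_eq; [reflexivity|apply pos_INR].
- exfalso.
  assert (Hw1 : (RtoC 1 - w)%C <> RtoC 0).
  { intros H; apply Hw; transitivity (RtoC 1 - (RtoC 1 - w))%C; [ring|].
    rewrite H; ring. }
  assert (Hm : Cmod w = 1).
  { unfold w; rewrite Cmod_mult, Cmod_conj; unfold u; rewrite !N; ring. }
  (* the centre of the rotation [p j |-> p (24 + j)] *)
  set (c := ((p 24%nat - w * p 0%nat) / (RtoC 1 - w))%C).
  assert (Hc : forall j, (p (24 + j)%nat - c)%C = (w * (p j - c))%C).
  { intros j; rewrite Hp; unfold c; field; assumption. }
  assert (Hcirc : forall k, Cmod (p (24 * k)%nat - c)%C = Cmod (p 0%nat - c)%C).
  { induction k as [|k IH]; [reflexivity|].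
    replace (24 * S k)%nat with (24 + 24 * k)%nat by lia.
    rewrite Hc, Cmod_mult, Hm, IH; ring. }
  (* The bound is the diameter of the circle that contains every [p (24 * k)]. *)
  destruct (Hinf (2 * Cmod (p 0%nat - c)%C)) as [k0 Hk0].
  specialize (Hk0 (24 * k0)%nat ltac:(lia)).
  pose proof (Cdist_tri (p (24 * k0)%nat) (p 0%nat) c) as Ht.
  rewrite Hcirc, (Cdist_sym c) in Ht; lra.
Qed.

(** * Pointwise adherence values of bounded sequences *)

(** Take rows that approach [l] on the first [K] coordinates and apply Bolzano-Weierstrass to
    coordinate [K] along them. *)
Lemma bounded_extension (F : nat -> nat -> R) (B : nat -> R) (l : nat -> R) (K : nat) :
  (forall n k, Rabs (F n k) <= B k) ->
  (forall eps N, 0 < eps -> exists n, (N <= n)%nat /\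
     forall k, (k < K)%nat -> Rabs (F n k - l k) < eps) ->
  exists v, forall eps N, 0 < eps -> exists n, (N <= n)%nat /\
     (forall k, (k < K)%nat -> Rabs (F n k - l k) < eps) /\ Rabs (F n K - v) < eps.
Proof.
intros HB Hl.
assert (Hch : forall j : nat, exists n, (j <= n)%nat /\
     forall k, (k < K)%nat -> Rabs (F n k - l k) < / INR (S j)).
{ intros j; apply Hl; apply Rinv_0_lt_compat, lt_0_INR; lia. }
apply functional_choice in Hch as [f Hf].
destruct (Bolzano_Weierstrass (fun j => F (f j) K) (fun c => - B K <= c <= B K))
  as [v Hv].
- apply compact_P3.
- intros j; specialize (HB (f j) K); apply Rabs_le_between in HB; exact HB.
- exists v; intros eps N Heps.
  destruct (archimed_cor1 eps Heps) as (N' & HN' & HN'0).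
  destruct (Hv (disc v (mkposreal eps Heps)) (Nat.max N N')) as (j & Hj & Hd).
  { exists (mkposreal eps Heps); intros y Hy; exact Hy. }
  destruct (Hf j) as [H1 H2].
  exists (f j); split; [lia|]; split; [|exact Hd].
  intros k Hk; eapply Rlt_trans; [now apply H2|].
  eapply Rle_lt_trans; [|exact HN'].
  apply Rinv_le_contravar; [apply lt_0_INR; lia|apply le_INR; lia].
Qed.

(** A diagonal argument without nested subsequences: [l] is built one coordinate at a time, keeping
    the invariant that arbitrarily late rows approach it on the coordinates fixed so far. *)
Lemma pointwise_bounded_adherent (F : nat -> nat -> R) (B : nat -> R) :
  (forall n k, Rabs (F n k) <= B k) ->
  exists l : nat -> R, forall K eps N, 0 < eps -> exists n, (N <= n)%nat /\
     forall k, (k < K)%nat -> Rabs (F n k - l k) < eps.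
Proof.
intros HB.
set (adh (l : nat -> R) K := forall eps N, 0 < eps -> exists n, (N <= n)%nat /\
     forall k, (k < K)%nat -> Rabs (F n k - l k) < eps).
assert (Hext : forall s : nat * (nat -> R), exists v,
  adh (snd s) (fst s) -> forall eps N, 0 < eps -> exists n, (N <= n)%nat /\
     (forall k, (k < fst s)%nat -> Rabs (F n k - snd s k) < eps) /\
     Rabs (F n (fst s) - v) < eps).
(* The choice function must be total; the value 0 is a default where the invariant fails. *)
{ intros [K l]; simpl; destruct (classic (adh l K)) as [H|H].
  - destruct (bounded_extension F B l K HB H) as [v Hv]; exists v; auto.
  - exists 0; tauto. }
apply functional_choice in Hext as [e He].
set (upd (l : nat -> R) K v k := if Nat.eqb k K then v else l k).
set (L := fix L K : nat -> R := match K with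
  | O => fun _ => 0
  | S K' => upd (L K') K' (e (K', L K')) end).
assert (HL : forall K, adh (L K) K).
{ intros K; induction K as [|K IH].
  - intros eps N _; exists N; split; [lia|]; intros k Hk; lia.
  - intros eps N Heps; destruct (He (K, L K) IH eps N Heps) as (n & Hn & H1 & H2).
    exists n; split; [assumption|]; intros k Hk; simpl in *; unfold upd.
    destruct (Nat.eqb_spec k K) as [->|Hne]; [assumption|apply H1; lia]. }
(* Later stages leave an entry unchanged, so the diagonal agrees with [L K] below [K]. *)
assert (Hstab : forall K k, (k < K)%nat -> L K k = L (S k) k).
{ intros K k; induction K as [|K IH]; intros Hk; [lia|].
  destruct (Nat.eq_dec k K) as [->|Hne]; [reflexivity|].
  rewrite <- IH by lia; simpl; unfold upd at 1.
  destruct (Nat.eqb_spec k K); [lia|reflexivity]. }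
exists (fun k => L (S k) k); intros K eps N Heps.
destruct (HL K eps N Heps) as (n & Hn & H); exists n; split; [assumption|].
intros k Hk; rewrite <- (Hstab K) by assumption; now apply H.
Qed.

Lemma Cmod_le_sum (z : C) : Cmod z <= Rabs (Re z) + Rabs (Im z).
Proof.
replace z with (RtoC (Re z) + RtoC (Im z) * Ci)%C
  by (apply injective_projections; simpl; unfold Re, Im; ring).
eapply Rle_trans; [apply Cmod_triangle|].
rewrite Cmod_mult, !Cmod_R, Cmod_Ci, Rmult_1_r; simpl; unfold Re, Im.
apply Req_le; f_equal; f_equal; simpl; ring.
Qed.

Lemma Re_le_Cmod (z : C) : Rabs (Re z) <= Cmod z.
Proof. eapply Rle_trans; [|apply Rmax_Cmod]; apply Rmax_l. Qed.

Lemma Im_le_Cmod (z : C) : Rabs (Im z) <= Cmod z.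
Proof. eapply Rle_trans; [|apply Rmax_Cmod]; apply Rmax_r. Qed.

Lemma pointwise_bounded_adherent_C (F : nat -> nat -> C) (B : nat -> R) :
  (forall n k, Cmod (F n k) <= B k) ->
  exists l : nat -> C, forall K eps N, 0 < eps -> exists n, (N <= n)%nat /\
     forall k, (k < K)%nat -> Cmod (F n k - l k)%C < eps.
Proof.
intros HB.
(* Interleaving real and imaginary parts makes both converge along the same rows. *)
set (G n k := if Nat.even k then Re (F n (Nat.div2 k)) else Im (F n (Nat.div2 k))).
destruct (pointwise_bounded_adherent G (fun k => B (Nat.div2 k))) as [l Hl].
{ intros n k; unfold G; destruct (Nat.even k); (eapply Rle_trans; [|apply HB]);
    [apply Re_le_Cmod | apply Im_le_Cmod]. }
exists (fun k => (l (2 * k)%nat, l (S (2 * k)))); intros K eps N Heps.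
destruct (Hl (2 * K)%nat (eps / 2) N ltac:(lra)) as (n & Hn & H).
exists n; split; [assumption|]; intros k Hk.
pose proof (H (2 * k)%nat ltac:(lia)) as H1.
pose proof (H (S (2 * k)) ltac:(lia)) as H2.
unfold G in H1, H2.
rewrite Nat.even_even in H1.
replace (S (2 * k)) with (2 * k + 1)%nat in H2 by lia.
rewrite Nat.even_odd in H2.
replace (Nat.div2 (2 * k)) with k in H1 by (rewrite Nat.div2_double; reflexivity).
replace (Nat.div2 (2 * k + 1)) with k in H2
  by (rewrite Nat.add_1_r, Nat.div2_succ_double; reflexivity).
eapply Rle_lt_trans; [apply Cmod_le_sum|].
replace (S (2 * k)) with (2 * k + 1)%nat by lia.
assert (ER : Re (F n k - (l (2 * k)%nat, l (2 * k + 1)%nat))%C = Re (F n k) - l (2 * k)%nat)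
  by reflexivity.
assert (EI : Im (F n k - (l (2 * k)%nat, l (2 * k + 1)%nat))%C
  = Im (F n k) - l (2 * k + 1)%nat) by reflexivity.
rewrite ER, EI; lra.
Qed.

(** * The two metrics on the parameter line *)

Definition gap (phi : R -> C) (u v : R) : R := Cmod (phi u - phi v)%C.

(* [phi] parametrises [Gamma1] and [rho] is the metric of [Gamma2] read in the
   corresponding parameter of [Gamma2], so that [h] becomes the identity map
   from [(R, gap phi)] to [(R, rho)]. *)
Record line_pair (phi : R -> C) (rho : R -> R -> R) : Prop := {
  rho_pos : forall u v, u <> v -> 0 < rho u v;
  rho_self : forall u, rho u u = 0;
  rho_sym : forall u v, rho u v = rho v u;
  rho_tri : forall u v w, rho u w <= rho u v + rho v w;
  phi_inj : forall u v, phi u = phi v -> u = v;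
  phi_cont : forall x eps, 0 < eps -> exists delta, 0 < delta /\
    forall y, Rabs (y - x) < delta -> gap phi y x < eps;
  far_right : forall x B, exists v, x < v /\ B <= gap phi v x;
  far_left : forall x B, exists v, v < x /\ B <= gap phi v x;
  quasisym : forall t, exists c, 1 <= c /\
    forall a b x, gap phi a x <= t * gap phi b x -> rho a x <= c * rho b x;
  unif_cont : forall eps, 0 < eps -> exists delta, 0 < delta /\
    forall u v, gap phi u v < delta -> rho u v < eps;
  flat : forall eps, 0 < eps -> exists r, 0 < r /\
    forall u v w, u <= v <= w -> rho u w <= r ->
      rho u v + rho v w <= (1 + eps) * rho u w;
  equidist : forall eps, 0 < eps -> exists r, 0 < r /\
    forall a b x, gap phi a x = gap phi b x -> gap phi a x <= r ->
      rho a x <= (1 + eps) * rho b x }.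

Lemma gap_sym phi u v : gap phi u v = gap phi v u.
Proof. apply Cdist_sym. Qed.

Lemma gap_self phi u : gap phi u u = 0.
Proof. now apply Cdist_refl. Qed.

Lemma gap_tri phi u v w : gap phi u w <= gap phi u v + gap phi v w.
Proof. apply Cdist_tri. Qed.

Lemma gap_ge_0 phi u v : 0 <= gap phi u v.
Proof. apply Cmod_ge_0. Qed.

Lemma gap_pos phi rho : line_pair phi rho -> forall u v, u <> v -> 0 < gap phi u v.
Proof.
intros L u v H; destruct (gap_ge_0 phi u v) as [H'|H']; [assumption|].
exfalso; apply H, (phi_inj _ _ L), Cdist_refl; now symmetry.
Qed.

Lemma rho_ge_0 phi rho : line_pair phi rho -> forall u v, 0 <= rho u v.
Proof.
intros L u v; destruct (Req_dec u v) as [->|Hn];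
  [rewrite (rho_self _ _ L); lra | left; now apply (rho_pos _ _ L)].
Qed.


(** Reversing the line reduces the points to the left of [x] to those to its right. *)
Lemma line_pair_opp phi rho : line_pair phi rho ->
  line_pair (fun u => phi (- u)) (fun u v => rho (- u) (- v)).
Proof.
intros L.
assert (G : forall u v, gap (fun u => phi (- u)) u v = gap phi (- u) (- v))
  by reflexivity.
constructor.
- intros u v H; apply (rho_pos _ _ L); lra.
- intros u; apply (rho_self _ _ L).
- intros u v; apply (rho_sym _ _ L).
- intros u v w; apply (rho_tri _ _ L).
- intros u v H; apply (phi_inj _ _ L) in H; lra.
- intros x eps He; destruct (phi_cont _ _ L (- x) eps He) as (d & Hd & H).
  exists d; split; [assumption|]; intros y Hy; rewrite G; apply H.
  replace (- y - - x) with (- (y - x)) by ring; now rewrite Rabs_Ropp.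
- intros x B; destruct (far_left _ _ L (- x) B) as (v & Hv & H).
  exists (- v); rewrite G, Ropp_involutive; split; [lra|assumption].
- intros x B; destruct (far_right _ _ L (- x) B) as (v & Hv & H).
  exists (- v); rewrite G, Ropp_involutive; split; [lra|assumption].
- intros t; destruct (quasisym _ _ L t) as (c & Hc & H).
  exists c; split; [assumption|]; intros a b x; rewrite !G; apply H.
- intros eps He; destruct (unif_cont _ _ L eps He) as (d & Hd & H).
  exists d; split; [assumption|]; intros u v; rewrite G; apply H.
- intros eps He; destruct (flat _ _ L eps He) as (r & Hr & H).
  exists r; split; [assumption|]; intros u v w Hu Hw.
  rewrite (rho_sym _ _ L (- u) (- w)) in *.
  rewrite (rho_sym _ _ L (- u) (- v)), (rho_sym _ _ L (- v) (- w)).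
  rewrite Rplus_comm; apply H; [lra|assumption].
- intros eps He; destruct (equidist _ _ L eps He) as (r & Hr & H).
  exists r; split; [assumption|]; intros a b x; rewrite !G; apply H.
Qed.

Lemma gap_attained_right phi rho : line_pair phi rho ->
  forall x s, 0 < s -> exists v, x < v /\ gap phi v x = s.
Proof.
intros L x s Hs; destruct (far_right _ _ L x s) as (w & Hw & Hsw).
destruct (IVT_gen (fun v => gap phi v x) x w s) as (v & Hv & Hvs).
- intros y eps Heps; destruct (phi_cont _ _ L y eps Heps) as (d & Hd & H).
  exists d; split; [assumption|]; intros z [_ Hz]; specialize (H z Hz).
  simpl; unfold R_dist.
  pose proof (gap_tri phi z y x); pose proof (gap_tri phi y z x) as H'.
  rewrite (gap_sym phi y z) in H'; apply Rabs_def1; lra.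
- simpl; rewrite gap_self, Rmin_left, Rmax_right by lra; lra.
- exists v; rewrite Rmin_left in Hv by lra; split; [|assumption].
  destruct (Req_dec x v) as [->|]; [rewrite gap_self in Hvs; lra|lra].
Qed.

(** One of [v], [y] lies between [x] and the other, and by flatness [rho] is almost additive
    there. *)
Lemma fork phi rho : line_pair phi rho ->
  forall eps, 0 < eps -> exists r, 0 < r /\ forall x v y, x <= v -> x <= y ->
    rho v x <= r -> rho y x <= r ->
    rho v y <= Rabs (rho v x - rho y x) + eps * (rho v x + rho y x).
Proof.
intros L eps He; destruct (flat _ _ L eps He) as (r & Hr & H).
pose proof (rho_ge_0 _ _ L) as Hnn.
exists r; split; [assumption|]; intros x v y Hv Hy Hrv Hry.
pose proof (Hnn v x); pose proof (Hnn y x).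
pose proof (Rle_abs (rho v x - rho y x)).
pose proof (Rle_abs (- (rho v x - rho y x))) as Hab; rewrite Rabs_Ropp in Hab.
rewrite (rho_sym _ _ L v x), (rho_sym _ _ L y x) in *.
destruct (Rle_dec v y) as [Hvy|Hvy].
- specialize (H x v y (conj Hv Hvy) Hry); nra.
- assert (Hyv : y <= v) by lra.
  specialize (H x y v (conj Hy Hyv) Hrv); rewrite (rho_sym _ _ L v y); nra.
Qed.

(** * Walks of constant step and their blow-up limits *)

Definition lattice (phi : R -> C) (u : nat -> R) (s : R) : Prop :=
  0 < s /\ forall k, u k < u (S k) /\ gap phi (u (S k)) (u k) = s.

Lemma lattice_exists phi rho : line_pair phi rho ->
  forall x s, 0 < s -> exists u, u 0%nat = x /\ lattice phi u s.
Proof.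
intros L x s Hs.
destruct (functional_choice _ (fun y => gap_attained_right phi rho L y s Hs)) as [f Hf].
exists (fun k => Nat.iter k f x); split; [reflexivity|]; split; [assumption|].
intros k; apply Hf.
Qed.

Lemma lattice_incr phi u s : lattice phi u s -> forall i j, (i < j)%nat -> u i < u j.
Proof.
intros [_ H] i j Hij; induction Hij as [|j Hij IH]; [apply H|].
eapply Rlt_trans; [exact IH|apply H].
Qed.

Lemma lattice_gap_le phi u s : lattice phi u s ->
  forall i k, gap phi (u (i + k)%nat) (u i) <= INR k * s.
Proof.
intros [Hs H] i k; induction k as [|k IH].
- rewrite Nat.add_0_r, gap_self; simpl; lra.
- rewrite S_INR, Nat.add_succ_r; destruct (H (i + k)%nat) as [_ Hk].
  pose proof (gap_tri phi (u (S (i + k))) (u (i + k)%nat) (u i)); lra.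
Qed.

(** The starting points [U n 0] are free to move with [n]; this makes the estimates obtained by
    contradiction uniform along the line. *)
Record lattice_seq (phi : R -> C) (U : nat -> nat -> R) (s : nat -> R) : Prop := {
  seq_lattice : forall n, lattice phi (U n) (s n);
  seq_lim : is_lim_seq s 0 }.

Lemma eventually_and (P Q : nat -> Prop) :
  eventually P -> eventually Q -> eventually (fun n => P n /\ Q n).
Proof. apply (filter_and (F := eventually)). Qed.

Lemma lim_eventually (f : nat -> R) (l : R) : is_lim_seq f l ->
  forall eps, 0 < eps -> eventually (fun n => Rabs (f n - l) < eps).
Proof.
intros H eps He; apply is_lim_seq_spec in H; exact (H (mkposreal eps He)).
Qed.

Lemma eventually_lim (f : nat -> R) (l : R) :
  (forall eps, 0 < eps -> eventually (fun n => Rabs (f n - l) < eps)) -> is_lim_seq f l.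
Proof. intros H; apply is_lim_seq_spec; intros eps; exact (H eps (cond_pos eps)). Qed.

Lemma seq_gap_lim phi U s : lattice_seq phi U s ->
  forall i k, is_lim_seq (fun n => gap phi (U n (i + k)%nat) (U n i)) 0.
Proof.
intros HS i k; apply is_lim_seq_le_le with (u := fun _ => 0) (w := fun n => INR k * s n).
- intros n; split; [apply gap_ge_0|apply lattice_gap_le, HS].
- apply is_lim_seq_const.
- replace 0 with (INR k * 0) by ring.
  apply (is_lim_seq_mult' _ _ (INR k) 0); [apply is_lim_seq_const|apply HS].
Qed.

Lemma rho_lim phi rho : line_pair phi rho -> forall a b : nat -> R,
  is_lim_seq (fun n => gap phi (a n) (b n)) 0 -> is_lim_seq (fun n => rho (a n) (b n)) 0.
Proof.
intros L a b H; apply eventually_lim; intros eps He.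
destruct (unif_cont _ _ L eps He) as (d & Hd & Hu).
destruct (lim_eventually _ _ H d Hd) as [N HN]; exists N; intros n Hn.
specialize (HN n Hn); rewrite Rminus_0_r in *.
rewrite Rabs_pos_eq in HN by apply gap_ge_0.
rewrite Rabs_pos_eq; [now apply Hu|].
destruct (Req_dec (a n) (b n)) as [->|Hne];
  [rewrite (rho_self _ _ L); lra | left; now apply (rho_pos _ _ L)].
Qed.

Lemma equidist_lim phi rho : line_pair phi rho -> forall a b x : nat -> R,
  (forall n, a n <> x n) -> (forall n, b n <> x n) ->
  (forall n, gap phi (a n) (x n) = gap phi (b n) (x n)) ->
  is_lim_seq (fun n => gap phi (a n) (x n)) 0 ->
  is_lim_seq (fun n => rho (a n) (x n) / rho (b n) (x n)) 1.
Proof.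
intros L a b x Ha Hb Hg Hl; apply eventually_lim; intros eps He.
destruct (equidist _ _ L (eps / 2) ltac:(lra)) as (r & Hr & Heq).
destruct (lim_eventually _ _ Hl r Hr) as [N HN]; exists N; intros n Hn.
specialize (HN n Hn); rewrite Rminus_0_r, Rabs_pos_eq in HN by apply gap_ge_0.
pose proof (rho_pos _ _ L _ _ (Ha n)) as Pa.
pose proof (rho_pos _ _ L _ _ (Hb n)) as Pb.
assert (H1 := Heq (a n) (b n) (x n) (Hg n) ltac:(lra)).
assert (H2 := Heq (b n) (a n) (x n) (eq_sym (Hg n)) ltac:(rewrite <- Hg; lra)).
set (q := rho (a n) (x n) / rho (b n) (x n)).
assert (E : rho (a n) (x n) = q * rho (b n) (x n)) by (unfold q; field; lra).
rewrite E in H1, H2.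
assert (q <= 1 + eps / 2) by (apply Rmult_le_reg_r with (rho (b n) (x n)); lra).
assert (1 <= (1 + eps / 2) * q) by (apply Rmult_le_reg_r with (rho (b n) (x n)); lra).
apply Rabs_def1; nra.
Qed.

Definition unit_rho (rho : R -> R -> R) (u : nat -> R) : R := rho (u 1%nat) (u 0%nat).

Lemma unit_rho_pos phi rho u s : line_pair phi rho -> lattice phi u s -> 0 < unit_rho rho u.
Proof.
intros L H; apply (rho_pos _ _ L), Rgt_not_eq, (lattice_incr _ _ _ H); lia.
Qed.

(** Consecutive steps share an endpoint and have equal gap, so EWAS centred there makes the ratio of
    their [rho]-lengths tend to 1; multiply these ratios. *)
Lemma seq_rho_step phi rho U s : line_pair phi rho -> lattice_seq phi U s -> forall k,
  is_lim_seq (fun n => rho (U n (S k)) (U n k) / unit_rho rho (U n)) 1.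
Proof.
intros L HS k.
assert (Hinc : forall n i, U n i < U n (S i)) by (intros n i; apply HS).
assert (Hst : forall n i, gap phi (U n (S i)) (U n i) = s n)
  by (intros n i; apply HS).
induction k as [|k IH].
- apply is_lim_seq_ext with (fun _ => 1); [|apply is_lim_seq_const].
  intros n; pose proof (unit_rho_pos _ _ _ _ L (seq_lattice _ _ _ HS n)).
  unfold unit_rho in *; field; lra.
- apply is_lim_seq_ext with (fun n =>
    (rho (U n (S (S k))) (U n (S k))
      / rho (U n k) (U n (S k)))
    * (rho (U n (S k)) (U n k) / unit_rho rho (U n))).
  { intros n; pose proof (unit_rho_pos _ _ _ _ L (seq_lattice _ _ _ HS n)).
    rewrite (rho_sym _ _ L (U n k)).
    pose proof (rho_pos _ _ L (U n (S k)) (U n k)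
      (Rgt_not_eq _ _ (Hinc n k))); field; lra. }
  replace 1 with (1 * 1) at 1 by ring; apply is_lim_seq_mult'; [|exact IH].
  apply (equidist_lim _ _ L).
  + intros n; apply Rgt_not_eq, Hinc.
  + intros n; apply Rlt_not_eq, Hinc.
  + intros n; now rewrite (gap_sym phi (U n k)), !Hst.
  + apply is_lim_seq_ext with s; [intros n; now rewrite Hst|apply HS].
Qed.
(** Induction on [k]: each new step adds about one unit, and flatness makes the defect in the
    triangle inequality negligible. *)
Lemma seq_rho phi rho U s : line_pair phi rho -> lattice_seq phi U s -> forall i k,
  is_lim_seq (fun n => rho (U n (i + k)%nat) (U n i) / unit_rho rho (U n)) (INR k).
Proof.
intros L HS i k; induction k as [|k IH].
- apply is_lim_seq_ext with (fun _ => 0); [|apply is_lim_seq_const].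
  intros n; rewrite Nat.add_0_r, (rho_self _ _ L); unfold Rdiv; ring.
- rewrite Nat.add_succ_r, S_INR.
  set (A n := rho (U n (i + k)%nat) (U n i) / unit_rho rho (U n)) in *.
  set (B n := rho (U n (S (i + k))) (U n (i + k)%nat) / unit_rho rho (U n)).
  assert (HB : is_lim_seq B 1) by exact (seq_rho_step _ _ _ _ L HS _).
  assert (HAB : is_lim_seq (fun n => A n + B n) (INR k + 1))
    by exact (is_lim_seq_plus' _ _ _ _ IH HB).
  set (G n := rho (U n (S (i + k))) (U n i) / unit_rho rho (U n)).
  apply is_lim_seq_ext with (fun n => (A n + B n) - (A n + B n - G n));
    [intros n; ring|].
  replace (Finite (INR k + 1)) with (Finite (INR k + 1 - 0)) by (f_equal; ring).
  apply is_lim_seq_minus'; [exact HAB|].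
  apply eventually_lim; intros eps He.
  pose proof (pos_INR k) as Hk.
  (* Eventually [G n <= A n + B n < INR k + 2], so this tolerance keeps the defect below [eps]. *)
  destruct (flat _ _ L (eps / (INR k + 3))) as (r & Hr & Hf).
  { apply Rdiv_lt_0_compat; lra. }
  assert (Hsm : is_lim_seq (fun n => rho (U n (S (i + k))) (U n i)) 0).
  { apply (rho_lim _ _ L); rewrite <- Nat.add_succ_r; now apply (seq_gap_lim phi U s). }
  destruct (eventually_and _ _ (lim_eventually _ _ HAB 1 ltac:(lra))
    (lim_eventually _ _ Hsm r Hr)) as [N HN].
  exists N; intros n Hn; destruct (HN n Hn) as [H1 H2].
  pose proof (unit_rho_pos _ _ _ _ L (seq_lattice _ _ _ HS n)) as Hu.
  rewrite Rminus_0_r, Rabs_pos_eq in H2 by apply (rho_ge_0 _ _ L).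
  apply Rabs_def2 in H1.
  assert (Hle : forall j, U n i <= U n (i + j)%nat).
  { intros [|j]; [rewrite Nat.add_0_r; lra|].
    left; apply (lattice_incr _ _ _ (seq_lattice _ _ _ HS n)); lia. }
  specialize (Hf (U n i) (U n (i + k)%nat) (U n (S (i + k)))).
  rewrite (rho_sym _ _ L (U n i)), (rho_sym _ _ L (U n (i + k)%nat)),
    (rho_sym _ _ L (U n i)) in Hf.
  specialize (Hf (conj (Hle k) (Rlt_le _ _ (proj1 (proj2 (seq_lattice _ _ _ HS n) _))))
    ltac:(lra)).
  pose proof (rho_tri _ _ L (U n (S (i + k))) (U n (i + k)%nat) (U n i)) as Ht.
  pose proof (Rinv_0_lt_compat _ Hu) as Hi.
  apply Rmult_le_compat_r with (r := / unit_rho rho (U n)) in Hf; [|lra].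
  apply Rmult_le_compat_r with (r := / unit_rho rho (U n)) in Ht; [|lra].
  assert (Hf' : A n + B n <= G n + eps / (INR k + 3) * G n)
    by (unfold A, B, G, Rdiv in *; lra).
  assert (Ht' : G n <= A n + B n) by (unfold A, B, G, Rdiv in *; lra).
  assert (eps / (INR k + 3) * G n < eps).
  { assert (HG : G n < INR k + 3) by lra.
    apply Rmult_lt_compat_l with (r := eps / (INR k + 3)) in HG;
      [|apply Rdiv_lt_0_compat; lra].
    replace (eps / (INR k + 3) * (INR k + 3)) with eps in HG by (field; lra).
    exact HG. }
  rewrite Rminus_0_r; apply Rabs_def1; lra.
Qed.

(** Quasisymmetry carries closeness from [rho] back to [gap]: were [v n] farther than [tau * s n],
    the lattice step at [U n k] would be at most [c] times as long in [rho] as the distance to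
    [v n]. *)
Lemma seq_gap_small phi rho U s : line_pair phi rho -> lattice_seq phi U s ->
  forall (v : nat -> R) k,
  is_lim_seq (fun n => rho (v n) (U n k) / unit_rho rho (U n)) 0 ->
  forall tau, 0 < tau -> eventually (fun n => gap phi (v n) (U n k) <= tau * s n).
Proof.
intros L HS v k Hv tau Htau.
destruct (quasisym _ _ L (/ tau)) as (c & Hc & Hq).
destruct (eventually_and _ _
  (* After multiplication by [c] this stays below 1/2, while the step is longer than half a unit. *)
  (lim_eventually _ _ Hv (/ (2 * c)) ltac:(apply Rinv_0_lt_compat; lra))
  (lim_eventually _ _ (seq_rho_step _ _ _ _ L HS k) (1 / 2) ltac:(lra))) as [N HN].
exists N; intros n Hn; destruct (HN n Hn) as [H1 H2].
apply Rnot_lt_le; intros Hlt.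
destruct (seq_lattice _ _ _ HS n) as [Hs Hlat].
assert (Hu := unit_rho_pos _ _ _ _ L (seq_lattice _ _ _ HS n)).
assert (Hb : rho (U n (S k)) (U n k) <= c * rho (v n) (U n k)).
{ apply Hq; destruct (Hlat k) as [_ ->].
  apply Rmult_le_reg_l with tau; [assumption|].
  rewrite <- Rmult_assoc, Rinv_r by lra; lra. }
apply Rabs_def2 in H1; apply Rabs_def2 in H2.
apply Rmult_le_compat_r with (r := / unit_rho rho (U n)) in Hb;
  [|left; now apply Rinv_0_lt_compat].
assert (Hc2 : c * / (2 * c) = 1 / 2) by (field; lra).
assert (Hc3 : c * (rho (v n) (U n k) / unit_rho rho (U n)) < c * / (2 * c))
  by (apply Rmult_lt_compat_l; lra).
unfold Rdiv in *; lra.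
Qed.

(* Reflecting [U n j] in [U n (j + m)] gives a point whose [rho]-distances agree
   to first order with those of [U n (j + m + m)]; quasisymmetry then makes it
   close to that point in [gap]. *)
Lemma seq_gap_equidist phi rho U s : line_pair phi rho -> lattice_seq phi U s ->
  forall j m eps, 0 < eps -> eventually (fun n =>
    Rabs (gap phi (U n (j + m)%nat) (U n j)
          - gap phi (U n (j + m + m)%nat) (U n (j + m)%nat)) <= eps * s n).
Proof.
intros L HS j m eps Heps.
assert (Hs : forall n, 0 < s n) by (intros n; apply HS).
destruct m as [|m].
{ exists 0%nat; intros n _; rewrite !Nat.add_0_r, Rminus_diag, Rabs_R0.
  specialize (Hs n); nra. }
set (M := S m).
assert (Hne : forall n, U n j < U n (j + M)%nat)
  by (intros n; apply (lattice_incr _ _ _ (seq_lattice _ _ _ HS n)); lia).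
(* [v n] is the reflection of [U n j] in [U n (j + M)]: same gap, opposite side. *)
destruct (functional_choice (fun n v => U n (j + M)%nat < v /\
  gap phi v (U n (j + M)%nat) = gap phi (U n j) (U n (j + M)%nat))) as [v Hv].
{ intros n; apply (gap_attained_right _ _ L), (gap_pos _ _ L), Rlt_not_eq, Hne. }
set (x n := U n (j + M)%nat) in *; set (y n := U n (j + M + M)%nat).
assert (Hgx : is_lim_seq (fun n => gap phi (U n j) (x n)) 0).
{ apply is_lim_seq_ext with (fun n => gap phi (x n) (U n j));
    [intros n; apply gap_sym | now apply (seq_gap_lim _ _ _ HS)]. }
assert (Hgv : is_lim_seq (fun n => gap phi (v n) (x n)) 0).
{ apply is_lim_seq_ext with (2 := Hgx); intros n; symmetry; apply Hv. }
assert (Hry : is_lim_seq (fun n => rho (y n) (x n) / unit_rho rho (U n)) (INR M))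
  by exact (seq_rho _ _ _ _ L HS _ _).
assert (Hu : forall n, 0 < unit_rho rho (U n))
  by (intros n; exact (unit_rho_pos _ _ _ _ L (seq_lattice _ _ _ HS n))).
assert (Hrv : is_lim_seq (fun n => rho (v n) (x n) / unit_rho rho (U n)) (INR M)).
{ apply is_lim_seq_ext with (fun n => rho (v n) (x n) / rho (U n j) (x n)
    * (rho (x n) (U n j) / unit_rho rho (U n))).
  { intros n; rewrite (rho_sym _ _ L (x n)).
    pose proof (rho_pos _ _ L (U n j) (x n) (Rlt_not_eq _ _ (Hne n))).
    specialize (Hu n); field; lra. }
  replace (INR M) with (1 * INR M) by ring; apply is_lim_seq_mult'.
  - apply (equidist_lim _ _ L); [| |apply Hv|exact Hgv].
    + intros n; apply Rgt_not_eq, Hv.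
    + intros n; apply Rlt_not_eq, Hne.
  - exact (seq_rho _ _ _ _ L HS _ _). }
(* Both points lie to the right of [x n] at about [M] units, so [fork] puts them within a vanishing
   fraction of a unit of each other. *)
assert (Hvy : is_lim_seq (fun n => rho (v n) (y n) / unit_rho rho (U n)) 0).
{ apply eventually_lim; intros e He.
  pose proof (pos_INR M) as HM.
  assert (HD := is_lim_seq_minus' _ _ _ _ Hrv Hry); rewrite Rminus_diag in HD.
  assert (HP := is_lim_seq_plus' _ _ _ _ Hrv Hry).
  (* The two rescaled distances to [x n] eventually add up to less than [2 * INR M + 1]. *)
  assert (He' : 0 < e / 2 / (2 * INR M + 1)) by (apply Rdiv_lt_0_compat; lra).
  destruct (fork _ _ L _ He') as (r & Hr & Hf).
  destruct (eventually_and _ _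
    (eventually_and _ _ (lim_eventually _ _ HD (e / 2) ltac:(lra))
      (lim_eventually _ _ HP 1 ltac:(lra)))
    (eventually_and _ _
      (lim_eventually _ _ (rho_lim _ _ L _ _ Hgv) r Hr)
      (lim_eventually _ _ (rho_lim _ _ L _ _
         (seq_gap_lim _ _ _ HS (j + M) M)) r Hr))) as [N HN].
  exists N; intros n Hn; destruct (HN n Hn) as [[H1 H2] [H3 H4]].
  fold (x n) in H4; fold (y n) in H4.
  rewrite Rminus_0_r, Rabs_pos_eq in H3, H4 by apply (rho_ge_0 _ _ L).
  assert (Hxy : x n <= y n)
    by (left; apply (lattice_incr _ _ _ (seq_lattice _ _ _ HS n)); lia).
  specialize (Hf (x n) (v n) (y n) (Rlt_le _ _ (proj1 (Hv n))) Hxy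
    (Rlt_le _ _ H3) (Rlt_le _ _ H4)).
  specialize (Hu n); set (q := / unit_rho rho (U n)).
  assert (Hq : 0 < q) by now apply Rinv_0_lt_compat.
  apply Rmult_le_compat_r with (r := q) in Hf; [|lra].
  rewrite Rmult_plus_distr_r in Hf.
  rewrite <- (Rabs_pos_eq q) in Hf at 2 by lra; rewrite <- Rabs_mult in Hf.
  unfold Rdiv in *; fold q in H1, H2 |- *.
  rewrite Rminus_0_r in H1.
  replace ((rho (v n) (x n) - rho (y n) (x n)) * q)
    with (rho (v n) (x n) * q - rho (y n) (x n) * q) in Hf by ring.
  rewrite Rminus_0_r, Rabs_pos_eq
    by (apply Rmult_le_pos; [apply (rho_ge_0 _ _ L)|lra]).
  apply Rabs_def2 in H2.
  assert (Hlt : e * / 2 * / (2 * INR M + 1) *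
     (rho (v n) (x n) * q + rho (y n) (x n) * q) < e * / 2).
  { replace (e * / 2) with (e * / 2 * / (2 * INR M + 1) * (2 * INR M + 1)) at 2
      by (field; lra).
    apply Rmult_lt_compat_l; lra. }
  lra. }
destruct (seq_gap_small _ _ _ _ L HS v (j + M + M) Hvy eps Heps) as [N HN].
exists N; intros n Hn; specialize (HN n Hn); fold (y n) in HN |- *; fold (x n).
destruct (Hv n) as [_ Hg]; fold (x n) in Hg; rewrite (gap_sym phi (x n)), <- Hg.
pose proof (gap_tri phi (v n) (y n) (x n)).
pose proof (gap_tri phi (y n) (v n) (x n)) as Ht; rewrite (gap_sym phi (y n) (v n)) in Ht.
apply Rabs_le; lra.
Qed.

(** The [rho]-distance from the start grows like [k] units, whereas a gap of at most [T * s n] would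
    cap it at [c] units. This supplies the unboundedness of the blow-up limit. *)
Lemma seq_gap_growth phi rho U s : line_pair phi rho -> lattice_seq phi U s ->
  forall T, exists k0, forall k, (k0 <= k)%nat ->
    eventually (fun n => T * s n < gap phi (U n k) (U n 0%nat)).
Proof.
intros L HS T; destruct (quasisym _ _ L T) as (c & Hc & Hq).
destruct (nfloor_ex (c + 1) ltac:(lra)) as [k0 [_ Hk0]].
exists (S k0); intros k Hk.
assert (Hck : c < INR k) by (apply le_INR in Hk; rewrite S_INR in Hk; lra).
destruct (lim_eventually _ _ (seq_rho _ _ _ _ L HS 0 k) (INR k - c) ltac:(lra)) as [N HN].
exists N; intros n Hn; specialize (HN n Hn); apply Rabs_def2 in HN.
apply Rnot_le_lt; intros Hle.
destruct (seq_lattice _ _ _ HS n) as [Hs Hlat].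
assert (Hu := unit_rho_pos _ _ _ _ L (seq_lattice _ _ _ HS n)).
assert (Hb : rho (U n k) (U n 0%nat) <= c * unit_rho rho (U n)).
{ apply Hq; destruct (Hlat 0%nat) as [_ ->]; exact Hle. }
apply Rmult_le_compat_r with (r := / unit_rho rho (U n)) in Hb;
  [|left; now apply Rinv_0_lt_compat].
rewrite Rmult_assoc, Rinv_r in Hb by lra; simpl in HN; unfold Rdiv in HN; lra.
Qed.

Lemma le_all_eps_eq (x y c : R) : 0 < c ->
  (forall eps, 0 < eps -> Rabs (x - y) <= c * eps) -> x = y.
Proof.
intros Hc H; destruct (Req_dec x y) as [|Hne]; [assumption|exfalso].
assert (Hp : 0 < Rabs (x - y)) by (apply Rabs_pos_lt; lra).
specialize (H (Rabs (x - y) / (2 * c)) ltac:(apply Rdiv_lt_0_compat; lra)).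
replace (c * (Rabs (x - y) / (2 * c))) with (Rabs (x - y) / 2) in H by (field; lra).
lra.
Qed.

Lemma Cdist_diff (a b c d : C) :
  Rabs (Cmod (a - b)%C - Cmod (c - d)%C) <= Cmod (a - c)%C + Cmod (b - d)%C.
Proof.
pose proof (Cdist_tri a b c); pose proof (Cdist_tri c b d).
pose proof (Cdist_tri c d a); pose proof (Cdist_tri a d b).
rewrite (Cdist_sym c a), (Cdist_sym d b) in *; apply Rabs_le; lra.
Qed.

(* A blow-up limit of the lattices satisfies [equidistant_progression]. *)
Lemma seq_gap_linear phi rho U s : line_pair phi rho -> lattice_seq phi U s ->
  forall K N, exists n, (N <= n)%nat /\ forall k, (k <= K)%nat ->
    Rabs (gap phi (U n (24 * k)%nat) (U n 0%nat)
          - INR k * gap phi (U n 24%nat) (U n 0%nat)) <= s n.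
Proof.
intros L HS.
assert (Hs : forall n, 0 < s n) by (intros n; apply HS).
(* Translated and rescaled: every [P n] starts at 0 and has steps of length 1. *)
set (P n k := ((phi (U n k) - phi (U n 0%nat)) / RtoC (s n))%C).
assert (Hs0 : forall n, RtoC (s n) <> RtoC 0)
  by (intros n H; apply RtoC_inj in H; specialize (Hs n); lra).
assert (HP : forall n i j, Cmod (P n i - P n j)%C = gap phi (U n i) (U n j) / s n).
{ intros n i j; unfold gap.
  replace (P n i - P n j)%C with ((phi (U n i) - phi (U n j)) / RtoC (s n))%C
    by (unfold P; field; auto).
  rewrite Cmod_div, Cmod_R, Rabs_pos_eq; auto; specialize (Hs n); lra. }
assert (HP0 : forall n, P n 0%nat = RtoC 0) by (intros n; unfold P; field; auto).
destruct (pointwise_bounded_adherent_C P INR) as [p Hp].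
{ intros n k; replace (P n k) with (P n k - P n 0%nat)%C by (rewrite HP0; ring).
  rewrite HP; apply Rmult_le_reg_r with (s n); [auto|].
  unfold Rdiv; rewrite Rmult_assoc, Rinv_l, Rmult_1_r by (apply Rgt_not_eq, Hs).
  apply (lattice_gap_le _ _ _ (seq_lattice _ _ _ HS n) 0). }
assert (Hclose : forall K eps N, 0 < eps -> exists n, (N <= n)%nat /\
  forall i j, (i <= K)%nat -> (j <= K)%nat ->
    Rabs (gap phi (U n i) (U n j) / s n - Cmod (p i - p j)%C) <= 2 * eps).
{ intros K eps N He; destruct (Hp (S K) eps N He) as (n & Hn & H).
  exists n; split; [assumption|]; intros i j Hi Hj; rewrite <- HP.
  pose proof (H i ltac:(lia)) as H1; pose proof (H j ltac:(lia)) as H2.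
  pose proof (Cdist_diff (P n i) (P n j) (p i) (p j)); lra. }
assert (Hprog : forall k, Cmod (p (24 * k)%nat - p 0%nat)%C
    = INR k * Cmod (p 24%nat - p 0%nat)%C).
{ apply equidistant_progression.
  - intros j; apply (le_all_eps_eq _ _ 2); [lra|]; intros eps He.
    destruct (Hclose (S j) eps 0%nat He) as (n & _ & H).
    specialize (H (S j) j ltac:(lia) ltac:(lia)).
    destruct (seq_lattice _ _ _ HS n) as [_ Hlat]; destruct (Hlat j) as [_ E].
    rewrite E in H; unfold Rdiv in H; rewrite Rinv_r in H by (apply Rgt_not_eq, Hs).
    now rewrite Rabs_minus_sym.
  (* The 5 is twice the error [2 * eps] of [Hclose] plus the [eps] of [seq_gap_equidist]. *)
  - intros j m; apply (le_all_eps_eq _ _ 5); [lra|]; intros eps He.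
    destruct (seq_gap_equidist _ _ _ _ L HS j m eps He) as [N HN].
    destruct (Hclose (j + m + m)%nat eps N He) as (n & Hn & H).
    specialize (HN n Hn).
    pose proof (H (j + m)%nat j ltac:(lia) ltac:(lia)) as H1.
    pose proof (H (j + m + m)%nat (j + m)%nat ltac:(lia) ltac:(lia)) as H2.
    specialize (Hs n).
    set (A := gap phi (U n (j + m)%nat) (U n j)) in *.
    set (B := gap phi (U n (j + m + m)%nat) (U n (j + m)%nat)) in *.
    assert (H3 : Rabs (A / s n - B / s n) <= eps).
    { replace (A / s n - B / s n) with ((A - B) / s n) by (field; lra).
      unfold Rdiv; rewrite Rabs_mult, (Rabs_pos_eq (/ s n))
        by (left; now apply Rinv_0_lt_compat).
      apply Rmult_le_reg_r with (s n); [assumption|].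
      rewrite Rmult_assoc, Rinv_l by lra; lra. }
    apply Rabs_le_between in H1; apply Rabs_le_between in H2;
    apply Rabs_le_between in H3; apply Rabs_le; lra.
  - intros B; destruct (seq_gap_growth _ _ _ _ L HS (B + 3)) as [k0 Hk0].
    exists k0; intros k Hk; destruct (Hk0 k Hk) as [N HN].
    destruct (Hclose k 1 N ltac:(lra)) as (n & Hn & H).
    specialize (HN n Hn); specialize (H k 0%nat ltac:(lia) ltac:(lia)).
    specialize (Hs n).
    assert (B + 3 < gap phi (U n k) (U n 0%nat) / s n).
    { apply Rmult_lt_reg_r with (s n); [assumption|].
      unfold Rdiv; rewrite Rmult_assoc, Rinv_l by lra; lra. }
    apply Rabs_le_between in H; lra. }
intros K N; pose proof (pos_INR K) as HK.
(* The errors [2 * eps] at index [24 * k] and [k] times [2 * eps] at index 24 then add up to at most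
   1. *)
set (eps := / (2 * (INR K + 1))).
assert (He : 0 < eps) by (apply Rinv_0_lt_compat; lra).
destruct (Hclose (24 * K + 24)%nat eps N He) as (n & Hn & H).
exists n; split; [assumption|]; intros k Hk.
pose proof (H (24 * k)%nat 0%nat ltac:(lia) ltac:(lia)) as H1.
pose proof (H 24%nat 0%nat ltac:(lia) ltac:(lia)) as H2.
rewrite Hprog in H1; specialize (Hs n).
set (A := gap phi (U n (24 * k)%nat) (U n 0%nat)) in *.
set (D := gap phi (U n 24%nat) (U n 0%nat)) in *.
assert (H3 : Rabs (INR k * (D / s n) - INR k * Cmod (p 24%nat - p 0%nat)%C)
  <= INR k * (2 * eps)).
{ rewrite <- Rmult_minus_distr_l, Rabs_mult, Rabs_pos_eq by apply pos_INR.
  apply Rmult_le_compat_l; [apply pos_INR|assumption]. }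
assert (H4 : Rabs (A / s n - INR k * (D / s n)) <= 1).
{ apply le_INR in Hk.
  assert (E : 1 = 2 * eps + INR K * (2 * eps)) by (unfold eps; field; lra).
  assert (INR k * (2 * eps) <= INR K * (2 * eps)) by (apply Rmult_le_compat_r; lra).
  apply Rabs_le_between in H1; apply Rabs_le_between in H3; apply Rabs_le; lra. }
replace (A - INR k * D) with ((A / s n - INR k * (D / s n)) * s n) by (field; lra).
rewrite Rabs_mult, (Rabs_pos_eq (s n)) by lra.
apply Rmult_le_compat_r with (r := s n) in H4; lra.
Qed.

Lemma eventually_bounded_forall (P : nat -> nat -> Prop) (K : nat) :
  (forall k, eventually (fun n => P n k)) ->
  eventually (fun n => forall k, (k <= K)%nat -> P n k).
Proof.
intros H; induction K as [|K IH].
- destruct (H 0%nat) as [N HN]; exists N; intros n Hn k Hk.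
  replace k with 0%nat by lia; auto.
- destruct (eventually_and _ _ IH (H (S K))) as [N HN].
  exists N; intros n Hn k Hk; destruct (HN n Hn) as [H1 H2].
  destruct (Nat.eq_dec k (S K)) as [->|]; [assumption|apply H1; lia].
Qed.

(** Otherwise there are failing lattices with [s] at most [1 / (n + 1)]; they form a [lattice_seq],
    whose limit behaviour contradicts the failure. *)
Lemma lattice_linear phi rho : line_pair phi rho -> forall K, exists delta, 0 < delta /\
  forall u s, lattice phi u s -> s <= delta ->
    (forall k, (k <= K)%nat ->
      Rabs (gap phi (u (24 * k)%nat) (u 0%nat) - INR k * gap phi (u 24%nat) (u 0%nat)) <= s) /\
    (forall i j, (i <= K)%nat -> (j <= K)%nat ->
      Rabs (rho (u (i + j)%nat) (u i) - INR j * unit_rho rho u) <= unit_rho rho u).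
Proof.
intros L K; apply NNPP; intros Hno.
assert (Hseq : forall n : nat, exists us : (nat -> R) * R,
  (lattice phi (fst us) (snd us) /\ snd us <= / INR (S n)) /\
  ~ ((forall k, (k <= K)%nat ->
      Rabs (gap phi (fst us (24 * k)%nat) (fst us 0%nat)
        - INR k * gap phi (fst us 24%nat) (fst us 0%nat)) <= snd us) /\
    (forall i j, (i <= K)%nat -> (j <= K)%nat ->
      Rabs (rho (fst us (i + j)%nat) (fst us i) - INR j * unit_rho rho (fst us))
        <= unit_rho rho (fst us)))).
{ intros n; apply NNPP; intros Hn; apply Hno; exists (/ INR (S n)); split.
  { apply Rinv_0_lt_compat, lt_0_INR; lia. }
  intros u s Hl Hs; apply NNPP; intros H; apply Hn; exists (u, s); auto. }
apply functional_choice in Hseq as [F HF].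
assert (HS : lattice_seq phi (fun n => fst (F n)) (fun n => snd (F n))).
{ split; [intros n; apply HF|].
  apply is_lim_seq_le_le with (u := fun _ => 0) (w := fun n => / INR (S n)).
  - intros n; split; [left; apply HF|apply HF].
  - apply is_lim_seq_const.
  - apply (is_lim_seq_incr_1 (fun n => / INR n)).
    apply is_lim_seq_spec; intros eps.
    destruct (archimed_cor1 eps (cond_pos eps)) as (N & HN & HN0).
    exists N; intros n Hn; rewrite Rminus_0_r, Rabs_pos_eq.
    + eapply Rle_lt_trans; [|exact HN]; apply Rinv_le_contravar;
        [apply lt_0_INR; lia|now apply le_INR].
    + left; apply Rinv_0_lt_compat, lt_0_INR; lia. }
assert (Hrho : eventually (fun n => forall i, (i <= K)%nat -> forall j, (j <= K)%nat ->
   Rabs (rho (fst (F n) (i + j)%nat) (fst (F n) i) - INR j * unit_rho rho (fst (F n)))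
     <= unit_rho rho (fst (F n)))).
{ apply eventually_bounded_forall with (P := fun n i => forall j, (j <= K)%nat -> _);
    intros i; apply eventually_bounded_forall; intros j.
  destruct (lim_eventually _ _ (seq_rho _ _ _ _ L HS i j) 1 ltac:(lra)) as [N HN].
  exists N; intros n Hn; specialize (HN n Hn); simpl in HN.
  assert (Hu := unit_rho_pos _ _ _ _ L (seq_lattice _ _ _ HS n)); simpl in Hu.
  set (q := unit_rho rho (fst (F n))) in *.
  set (A := rho (fst (F n) (i + j)%nat) (fst (F n) i)) in *.
  replace (A - INR j * q) with ((A / q - INR j) * q) by (field; lra).
  rewrite Rabs_mult, (Rabs_pos_eq q) by lra.
  apply Rlt_le, Rmult_le_compat_r with (r := q) in HN; lra. }
destruct Hrho as [N HN].
(* The [rho]-estimates hold for all late [n], the [gap]-estimates only for arbitrarily late ones, so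
   [N] comes first. *)
destruct (seq_gap_linear _ _ _ _ L HS K N) as (n & Hn & H).
destruct (HF n) as [_ Hnot]; apply Hnot; split; [exact H|].
intros i j Hi Hj; exact (HN n Hn i Hi j Hj).
Qed.

(** * Comparing ratios in the two metrics around a point *)

Lemma between_multiples (u : nat -> R) (a : R) (q n : nat) :
  u 0%nat < a -> a <= u (q * n)%nat ->
  exists k, (k <= n)%nat /\ u (q * k)%nat <= a <= u (q * k + q)%nat.
Proof.
intros H0; induction n as [|n IH]; intros Hn.
- rewrite Nat.mul_0_r in Hn; lra.
- destruct (Rle_dec a (u (q * n)%nat)) as [H|H].
  + destruct (IH H) as (k & Hk & Hk'); exists k; split; [lia|assumption].
  + exists n; split; [lia|]; rewrite <- Nat.mul_succ_r; lra.
Qed.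

(** The errors come from one block of 24 steps, so [c] is independent of [T]; hence [T] can later be
    taken large compared with [c]. *)
Lemma lattice_locate phi rho : line_pair phi rho ->
  exists c, 0 < c /\ forall T, 0 < T -> exists delta, 0 < delta /\
  forall u s a, lattice phi u s -> s <= delta -> u 0%nat < a ->
    gap phi a (u 0%nat) <= T * s ->
    exists k, Rabs (rho a (u 0%nat) - 24 * INR k * unit_rho rho u) <= 51 * unit_rho rho u /\
      Rabs (gap phi a (u 0%nat) - INR k * gap phi (u 24%nat) (u 0%nat)) <= c * s.
Proof.
intros L; destruct (quasisym _ _ L 1) as (c1 & Hc1 & Hq1).
(* [J] steps cover more than [50 * c1] units; by quasisymmetry a point within 50 units of a lattice
   point is then within gap [J * s] of it. *)
destruct (nfloor_ex (1 + 50 * c1) ltac:(lra)) as [J0 [_ HJ0]].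
set (J := S J0); assert (HJ : 1 + 50 * c1 < INR J) by (unfold J; rewrite S_INR; lra).
exists (INR J + 1); split; [lra|]; intros T HT.
destruct (quasisym _ _ L T) as (cT & HcT & HqT).
(* [rho a (u 0)] is at most [cT] units, so [S K0] blocks of 24 steps reach past [a]. *)
destruct (nfloor_ex cT ltac:(lra)) as [K0 [_ HK0]].
destruct (lattice_linear _ _ L (24 * (S K0) + 24 + J)) as (dl & Hdl & Hlin).
(* With tolerance 1, flatness says that a subsegment is at most twice as long as the whole; uniform
   continuity supplies the smallness it requires. *)
destruct (flat _ _ L 1 ltac:(lra)) as (r & Hr & Hflat).
destruct (unif_cont _ _ L r Hr) as (du & Hdu & Huc).
exists (Rmin dl (du / (2 * (T + 24)))); split.
{ apply Rmin_pos; [assumption|apply Rdiv_lt_0_compat; lra]. }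
intros u s a Hl Hs Ha HaT.
destruct (Hlin u s Hl ltac:(eapply Rle_trans; [exact Hs|apply Rmin_l])) as [Hgap Hrho].
assert (Hsd : (T + 24) * s < du).
{ assert (H : s <= du / (2 * (T + 24))) by (eapply Rle_trans; [exact Hs|apply Rmin_r]).
  apply Rmult_le_compat_l with (r := T + 24) in H; [|lra].
  replace ((T + 24) * (du / (2 * (T + 24)))) with (du / 2) in H by (field; lra); lra. }
assert (Hu := unit_rho_pos _ _ _ _ L Hl).
destruct Hl as [Hs0 Hl'] eqn:E; clear E.
assert (Hstep := lattice_gap_le phi u s Hl).
assert (Hinc := lattice_incr phi u s Hl).
set (q := unit_rho rho u) in *.
assert (HaK : a <= u (24 * S K0)%nat).
{ apply Rnot_lt_le; intros Hlt.
  assert (H1 : rho (u 0%nat) (u (24 * S K0)%nat) + rho (u (24 * S K0)%nat) a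
     <= (1 + 1) * rho (u 0%nat) a).
  { apply Hflat; [split; left; [apply Hinc; lia|assumption]|].
    rewrite (rho_sym _ _ L); left; apply Huc; nra. }
  pose proof (rho_ge_0 _ _ L (u (24 * S K0)%nat) a).
  pose proof (Hrho 0%nat (24 * S K0)%nat ltac:(lia) ltac:(lia)) as H2.
  rewrite Nat.add_0_l in H2; apply Rabs_le_between in H2.
  rewrite mult_INR, (S_INR K0) in H2; replace (INR 24) with 24 in H2 by (simpl; ring).
  assert (H3 : rho a (u 0%nat) <= cT * q).
  { apply HqT; destruct (Hl' 0%nat) as [_ ->]; exact HaT. }
  rewrite (rho_sym _ _ L (u 0%nat)), (rho_sym _ _ L (u 0%nat) a) in H1.
  nra. }
destruct (between_multiples u a 24 (S K0) Ha HaK)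
  as (k & Hk & Hka & Hka').
set (y := u (24 * k)%nat) in *; set (z := u (24 * k + 24)%nat) in *.
assert (Hzy : rho y z <= 25 * q).
{ pose proof (Hrho (24 * k)%nat 24%nat ltac:(lia) ltac:(lia)) as H2.
  fold y z in H2; apply Rabs_le_between in H2.
  replace (INR 24) with 24 in H2 by (simpl; ring).
  rewrite (rho_sym _ _ L); lra. }
assert (Hay : rho a y <= 50 * q).
{ assert (H1 : rho y a + rho a z <= (1 + 1) * rho y z).
  { apply Hflat; [lra|]; rewrite (rho_sym _ _ L); left; apply Huc.
    eapply Rle_lt_trans; [apply Hstep|]; replace (INR 24) with 24 by (simpl; ring); nra. }
  pose proof (rho_ge_0 _ _ L a z); rewrite (rho_sym _ _ L a y); lra. }
assert (Hgay : gap phi a y <= INR J * s).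
{ apply Rnot_lt_le; intros Hlt.
  pose proof (Hrho (24 * k)%nat J ltac:(lia) ltac:(lia)) as H2; fold y in H2.
  apply Rabs_le_between in H2.
  assert (H3 : rho (u (24 * k + J)%nat) y <= c1 * rho a y).
  { apply Hq1; rewrite Rmult_1_l; eapply Rle_trans; [apply Hstep|lra]. }
  nra. }
(* A block has length at most 25 units, so [a] is within 50 of its left end; linearity of the
   lattice adds one unit in [rho] and one [s] in [gap], giving 51 and [INR J + 1]. *)
exists k; split.
- pose proof (Hrho 0%nat (24 * k)%nat ltac:(lia) ltac:(lia)) as H2.
  rewrite Nat.add_0_l in H2; fold y in H2; apply Rabs_le_between in H2.
  rewrite mult_INR in H2; replace (INR 24) with 24 in H2 by (simpl; ring).
  pose proof (rho_tri _ _ L a y (u 0%nat)).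
  pose proof (rho_tri _ _ L y a (u 0%nat)) as H3.
  rewrite (rho_sym _ _ L y a) in H3; apply Rabs_le; lra.
- pose proof (Hgap k ltac:(lia)) as H2; fold y in H2; apply Rabs_le_between in H2.
  pose proof (gap_tri phi a y (u 0%nat)).
  pose proof (gap_tri phi y a (u 0%nat)) as H3.
  rewrite (gap_sym phi y a) in H3; apply Rabs_le; lra.
Qed.

(** A lattice from [x] with [gap phi b x = M * s] counts blocks up to [a] and [b] in both metrics.
    The additive errors do not depend on [M], so a large [M] makes them relatively small. *)
Lemma asymptotic_right phi rho : line_pair phi rho ->
  forall t eps, 0 < t -> 0 < eps -> exists delta, 0 < delta /\
  forall a b x, x < a -> x < b -> gap phi b x <= delta ->
    gap phi a x <= t * gap phi b x -> rho a x <= (1 + eps) * t * rho b x.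
Proof.
intros L t eps Ht He.
destruct (lattice_locate _ _ L) as (c & Hc & Hloc).
(* [M] solves [t * M + c + 51 <= (1 + eps) * t * (M - c - 51)]. *)
set (M := (c + 51) * (1 + (1 + eps) * t) / (eps * t) + c + 51).
assert (Het : 0 < eps * t) by nra.
assert (HMc : c + 51 < M).
{ assert (0 < (c + 51) * (1 + (1 + eps) * t) / (eps * t)).
  { apply Rdiv_lt_0_compat; [|assumption]; apply Rmult_lt_0_compat; nra. }
  unfold M; lra. }
assert (HM : t * M + c + 51 <= (1 + eps) * t * (M - c - 51)).
{ assert (Hm : (eps * t) * (M - c - 51) = (c + 51) * (1 + (1 + eps) * t))
    by (unfold M; field; nra).
  nra. }
(* The range covers both [b], at gap [M * s], and [a], at gap at most [t * M * s]. *)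
destruct (Hloc ((1 + t) * M) ltac:(nra)) as (d & Hd & Hk).
exists d; split; [assumption|]; intros a b x Ha Hb Hbd Hab.
set (s := gap phi b x / M).
assert (Hb0 : 0 < gap phi b x) by (apply (gap_pos _ _ L); lra).
assert (Hs : 0 < s) by (apply Rdiv_lt_0_compat; lra).
assert (EM : gap phi b x = M * s) by (unfold s; field; lra).
destruct (lattice_exists _ _ L x s Hs) as (u & Hu0 & Hl).
assert (Hsd : s <= d) by nra.
destruct (Hk u s a Hl Hsd ltac:(lra) ltac:(rewrite Hu0; nra)) as (ka & Ha1 & Ha2).
destruct (Hk u s b Hl Hsd ltac:(lra) ltac:(rewrite Hu0; nra)) as (kb & Hb1 & Hb2).
assert (Hu := unit_rho_pos _ _ _ _ L Hl).
pose proof (lattice_gap_le phi u s Hl 0 24) as HD.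
assert (HD0 : 0 < gap phi (u (0 + 24)%nat) (u 0%nat)).
{ apply (gap_pos _ _ L), Rgt_not_eq, (lattice_incr _ _ _ Hl); lia. }
rewrite Nat.add_0_l in HD, HD0; replace (INR 24) with 24 in HD by (simpl; ring).
rewrite Hu0 in *.
set (D := gap phi (u 24%nat) x) in *; set (q := unit_rho rho u) in *.
apply Rabs_le_between in Ha1; apply Rabs_le_between in Ha2;
apply Rabs_le_between in Hb1; apply Rabs_le_between in Hb2.
(* A block has gap [D <= 24 * s], hence [1 <= 24 * m], which absorbs the 51 units into multiples of
   [24 * m]. *)
set (m := s / D); assert (Em : s = m * D) by (unfold m; field; lra).
assert (Hm : 1 <= 24 * m) by nra.
assert (Hka : INR ka <= (t * M + c) * m).
{ apply Rmult_le_reg_r with D; [assumption|]. nra. }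
assert (Hkb : (M - c) * m <= INR kb).
{ apply Rmult_le_reg_r with D; [assumption|]. nra. }
assert (H1 : rho a x <= 24 * m * (t * M + c + 51) * q).
{ apply Rle_trans with ((24 * INR ka + 51) * q); [lra|].
  apply Rmult_le_compat_r; [lra|]; nra. }
assert (H2 : 24 * m * (M - c - 51) * q <= rho b x).
{ apply Rle_trans with ((24 * INR kb - 51) * q); [|lra].
  apply Rmult_le_compat_r; [lra|]; nra. }
apply Rle_trans with (1 := H1).
apply Rle_trans with ((1 + eps) * t * (24 * m * (M - c - 51) * q)).
- replace ((1 + eps) * t * (24 * m * (M - c - 51) * q))
    with ((24 * m) * q * ((1 + eps) * t * (M - c - 51))) by ring.
  replace (24 * m * (t * M + c + 51) * q)
    with ((24 * m) * q * (t * M + c + 51)) by ring.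
  apply Rmult_le_compat_l; [apply Rmult_le_pos; lra|assumption].
- apply Rmult_le_compat_l; [nra|assumption].
Qed.

(** A [b] on the left of [x] is replaced by a point on the right at the same gap; EWAS makes this
    cost only a factor [1 + e]. *)
Lemma asymptotic_above phi rho : line_pair phi rho ->
  forall t eps, 0 < t -> 0 < eps -> exists delta, 0 < delta /\
  forall a b x, x < a -> b <> x -> gap phi b x <= delta ->
    gap phi a x <= t * gap phi b x -> rho a x <= (1 + eps) * t * rho b x.
Proof.
intros L t eps Ht He.
(* For [e <= 1] one has [(1 + e)^2 <= 1 + 3 * e]. *)
set (e := Rmin 1 (eps / 3)).
assert (He0 : 0 < e) by (apply Rmin_pos; lra).
assert (He1 : e <= 1) by apply Rmin_l.
assert (He3 : e <= eps / 3) by apply Rmin_r.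
destruct (asymptotic_right _ _ L t e Ht He0) as (d & Hd & Hr).
destruct (equidist _ _ L e He0) as (r & Hr0 & Heq).
exists (Rmin d r); split; [now apply Rmin_pos|]; intros a b x Ha Hb Hbd Hab.
destruct (gap_attained_right _ _ L x _ (gap_pos _ _ L b x Hb)) as (b' & Hb' & Hg).
assert (H1 : rho a x <= (1 + e) * t * rho b' x).
{ apply Hr; [assumption|assumption| |]; rewrite Hg; [|assumption].
  eapply Rle_trans; [exact Hbd|apply Rmin_l]. }
assert (H2 : rho b' x <= (1 + e) * rho b x).
{ apply Heq; [assumption|]; rewrite Hg; eapply Rle_trans; [exact Hbd|apply Rmin_r]. }
pose proof (rho_ge_0 _ _ L b x).
assert (H3 : (1 + e) * (1 + e) <= 1 + eps) by nra.
apply Rle_trans with (1 := H1).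
apply Rle_trans with ((1 + e) * t * ((1 + e) * rho b x)).
- apply Rmult_le_compat_l; [nra|assumption].
- replace ((1 + e) * t * ((1 + e) * rho b x))
    with ((1 + e) * (1 + e) * (t * rho b x)) by ring.
  rewrite (Rmult_assoc (1 + eps)); apply Rmult_le_compat_r; [nra|assumption].
Qed.

Lemma line_pair_asymptotic phi rho : line_pair phi rho ->
  forall t eps, 0 < t -> 0 < eps -> exists delta, 0 < delta /\
  forall a b x, a <> x -> b <> x -> gap phi b x <= delta ->
    gap phi a x <= t * gap phi b x -> rho a x <= (1 + eps) * t * rho b x.
Proof.
intros L t eps Ht He.
destruct (asymptotic_above _ _ L t eps Ht He) as (d1 & Hd1 & H1).
destruct (asymptotic_above _ _ (line_pair_opp _ _ L) t eps Ht He) as (d2 & Hd2 & H2).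
exists (Rmin d1 d2); split; [now apply Rmin_pos|]; intros a b x Ha Hb Hbd Hab.
destruct (Rlt_le_dec x a) as [Hxa|Hax].
- apply H1; try assumption; eapply Rle_trans; [exact Hbd|apply Rmin_l].
- rewrite <- (Ropp_involutive a), <- (Ropp_involutive b), <- (Ropp_involutive x).
  apply H2; [lra|lra| |]; unfold gap; rewrite !Ropp_involutive; [|assumption].
  eapply Rle_trans; [exact Hbd|apply Rmin_r].
Qed.

(** * From quasilines to the parameter line *)

Lemma dist_ge_0 (X : Metric_Space) (a b : Base X) : 0 <= dist a b.
Proof. apply Rge_le, dist_pos. Qed.

Lemma dist_gt_0 (X : Metric_Space) (a b : Base X) : a <> b -> 0 < dist a b.
Proof.
intros H; destruct (dist_ge_0 X a b) as [H'|H']; [assumption|].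
exfalso; apply H, dist_refl; now symmetry.
Qed.

Lemma dist_self (X : Metric_Space) (a : Base X) : dist a a = 0.
Proof. now apply dist_refl. Qed.

(** Continuity of the inverse becomes a condition on [f] alone, one that already forces
    injectivity. *)
Lemma embedding_char (X Y : Metric_Space) (f : Base X -> Base Y) :
  embedding f <-> continuous_map f /\
    forall x (eps : posreal), exists delta : posreal,
      forall y, dist (f y) (f x) < delta -> dist y x < eps.
Proof.
split.
- intros (Hc & g & Hg & Hgf & _); split.
  + intros x eps; destruct (Hc x eps) as [d Hd]; exists d; exact Hd.
  + intros x eps; destruct (Hg (corestrict f x) eps) as [d Hd]; exists d.
    intros y Hy; specialize (Hd (corestrict f y) Hy); now rewrite !Hgf in Hd.
- intros [Hc Hi]; split.
  + intros x eps; destruct (Hc x eps) as [d Hd]; exists d; exact Hd.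
  + assert (Hinj : forall x y, f x = f y -> x = y).
    { intros x y E; apply NNPP; intros Hne.
      destruct (Hi y (mkposreal _ (dist_gt_0 _ _ _ Hne))) as [d Hd].
      specialize (Hd x); rewrite E, dist_self in Hd.
      specialize (Hd (cond_pos d)); simpl in Hd; lra. }
    destruct (functional_choice
      (fun (y : Base (subspace Y (range f))) x => f x = proj1_sig y)) as [g Hg].
    { intros [y [x Hx]]; exists x; exact Hx. }
    exists g; split; [|split].
    * intros y eps; destruct (Hi (g y) eps) as [d Hd]; exists d; intros z Hz.
      apply Hd; rewrite !Hg; exact Hz.
    * intros x; apply Hinj; now rewrite Hg.
    * intros y; apply sub_dist_refl; simpl; rewrite Hg; apply dist_self.
Qed.

Lemma embedding_inj (X Y : Metric_Space) (f : Base X -> Base Y) :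
  embedding f -> forall x y, f x = f y -> x = y.
Proof.
intros [_ Hi]%embedding_char x y E; apply NNPP; intros Hne.
destruct (Hi y (mkposreal _ (dist_gt_0 _ _ _ Hne))) as [d Hd].
specialize (Hd x); rewrite E, dist_self in Hd.
specialize (Hd (cond_pos d)); simpl in Hd; lra.
Qed.

(** The product form avoids quotients and allows coinciding points; [1 <= c] handles [a = b]. *)
Lemma quasisymmetric_mult (X Y : Metric_Space) (h : Base X -> Base Y) :
  quasisymmetric h -> forall t, exists c, 1 <= c /\
    forall a b x, dist a x <= t * dist b x -> dist (h a) (h x) <= c * dist (h b) (h x).
Proof.
intros (Hemb & eta & _ & Heta) t.
(* [eta] lives on the half-line, so a negative [t] is replaced by 0. *)
set (t' := exist (fun r : R => 0 <= r) (Rmax 0 t) (Rmax_l 0 t) : Base half_line).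
exists (Rmax 1 (proj1_sig (eta t'))); split; [apply Rmax_l|]; intros a b x H.
assert (Hc := Rmax_l 1 (proj1_sig (eta t'))).
pose proof (dist_ge_0 _ (h a) (h x)) as Ha0.
pose proof (dist_ge_0 _ (h b) (h x)) as Hb0.
destruct (classic (a = x)) as [->|Hax].
{ rewrite dist_self; apply Rmult_le_pos; lra. }
destruct (classic (b = x)) as [->|Hbx].
{ rewrite dist_self, Rmult_0_r in H; pose proof (dist_gt_0 _ _ _ Hax); lra. }
destruct (classic (a = b)) as [->|Hab].
{ rewrite <- (Rmult_1_l (dist (h b) (h x))) at 1; now apply Rmult_le_compat_r. }
assert (Hb := dist_gt_0 _ _ _ Hbx).
assert (Hhb : 0 < dist (h b) (h x)).
{ apply dist_gt_0; intros E; apply Hbx; exact (embedding_inj _ _ _ Hemb _ _ E). }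
specialize (Heta a b x t' (conj Hab (conj Hax Hbx))).
assert (Hr : dist a x / dist b x <= proj1_sig t').
{ apply Rmult_le_reg_r with (dist b x); [assumption|].
  unfold Rdiv; rewrite Rmult_assoc, Rinv_l, Rmult_1_r by lra.
  eapply Rle_trans; [exact H|]; apply Rmult_le_compat_r; [lra|apply Rmax_r]. }
specialize (Heta Hr).
replace (dist (h a) (h x)) with (dist (h a) (h x) / dist (h b) (h x) * dist (h b) (h x))
  by (field; lra).
apply Rmult_le_compat_r; [lra|].
eapply Rle_trans; [exact Heta|apply Rmax_r].
Qed.

(* The points [f (x + e * 2 ^ n)] are uniformly separated, so infinitely many of
   them do not fit into a disc. *)
Lemma weak_quasisymmetric_unbounded (f : R -> C) (c e : R) :
  0 < c -> e = 1 \/ e = -1 -> (forall u v, f u = f v -> u = v) ->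
  (forall a b x, Rabs (a - x) <= Rabs (b - x) ->
     Cmod (f a - f x)%C <= c * Cmod (f b - f x)%C) ->
  forall x B, exists n, B <= Cmod (f (x + e * 2 ^ n)%R - f x)%C.
Proof.
intros Hc He Hinj Hq x B; apply NNPP; intros Hno.
assert (HB : forall n, Cmod (f (x + e * 2 ^ n)%R - f x)%C <= B).
{ intros n; apply Rnot_lt_le; intros H; apply Hno; exists n; lra. }
assert (Habs : forall r, Rabs (e * r) = Rabs r).
{ intros r; destruct He as [->| ->]; rewrite Rabs_mult;
    [rewrite Rabs_R1|rewrite Rabs_m1]; ring. }
assert (Hp : forall n, 1 <= 2 ^ n) by (intros n; apply pow_R1_Rle; lra).
set (D := Cmod (f (x + e * 1)%R - f x)%C).
assert (HD : 0 < D).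
{ destruct (Cmod_ge_0 (f (x + e * 1)%R - f x)%C) as [H|H]; [exact H|].
  symmetry in H; apply Cdist_refl, Hinj in H; destruct He; lra. }
(* Weak quasisymmetry is used twice: at [x], from [1 <= 2 ^ i], and at [x + e * 2 ^ i], from
   [2 ^ i <= 2 ^ j - 2 ^ i]. *)
assert (Hsep : forall i j, (i < j)%nat ->
  D <= c * (c * Cmod (f (x + e * 2 ^ j)%R - f (x + e * 2 ^ i)%R)%C)).
{ intros i j Hij; eapply Rle_trans; [apply (Hq _ (x + e * 2 ^ i) x)|].
  - replace (x + e * 1 - x) with (e * 1) by ring.
    replace (x + e * 2 ^ i - x) with (e * 2 ^ i) by ring.
    rewrite !Habs, !Rabs_pos_eq; [apply Hp| |lra]; specialize (Hp i); lra.
  - apply Rmult_le_compat_l; [lra|]; rewrite (Cdist_sym _ (f x)); apply Hq.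
    replace (x - (x + e * 2 ^ i)) with (e * - 2 ^ i) by ring.
    replace (x + e * 2 ^ j - (x + e * 2 ^ i)) with (e * (2 ^ j - 2 ^ i)) by ring.
    rewrite !Habs, Rabs_Ropp.
    assert (Hle : 2 * 2 ^ i <= 2 ^ j).
    { change (2 * 2 ^ i) with (2 ^ S i); apply Rle_pow; [lra|lia]. }
    specialize (Hp i); rewrite !Rabs_pos_eq; lra. }
destruct (pointwise_bounded_adherent_C
  (fun n _ => (f (x + e * 2 ^ n)%R - f x)%C) (fun _ => B)) as [l Hl].
{ intros n _; apply HB. }
(* Two points within [eps] of the adherence value are closer together than the separation
   [D / (c * c)]. *)
set (eps := D / (2 * (c * c))).
assert (Heps : 0 < eps) by (apply Rdiv_lt_0_compat; nra).
destruct (Hl 1%nat eps 0%nat Heps) as (i & _ & Hi).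
destruct (Hl 1%nat eps (S i) Heps) as (j & Hij & Hj).
specialize (Hi 0%nat ltac:(lia)); specialize (Hj 0%nat ltac:(lia)).
specialize (Hsep i j ltac:(lia)).
pose proof (Cdist_tri (f (x + e * 2 ^ j)%R - f x) (f (x + e * 2 ^ i)%R - f x) (l 0%nat)) as Ht.
rewrite (Cdist_sym (l 0%nat)) in Ht.
replace (f (x + e * 2 ^ j)%R - f x - (f (x + e * 2 ^ i)%R - f x))%C
  with (f (x + e * 2 ^ j)%R - f (x + e * 2 ^ i)%R)%C in Ht by ring.
assert (Hlt : Cmod (f (x + e * 2 ^ j)%R - f (x + e * 2 ^ i)%R)%C < 2 * eps) by lra.
assert (E : c * (c * (2 * eps)) = D) by (unfold eps; field; lra).
rewrite <- E in Hsep at 1.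
apply Rmult_le_reg_l in Hsep; [|assumption].
apply Rmult_le_reg_l in Hsep; [|assumption]; lra.
Qed.

Lemma at_right_0_ex (P : R -> Prop) : at_right 0 P -> exists r, 0 < r /\ P r.
Proof.
intros [d Hd]; exists (d / 2); pose proof (cond_pos d); split; [lra|].
apply Hd; [|lra].
change (Rabs (d / 2 - 0) < d); rewrite Rminus_0_r, Rabs_pos_eq; lra.
Qed.

Lemma segment_is_subarc (Gamma : Base C_met -> Prop) (f : Base R_met -> Base C_met) (u w : R) :
  embedding f -> (forall v, Gamma (f v)) -> u < w ->
  is_subarc Gamma (f u) (f w) (fun z => exists v, u <= v <= w /\ z = f v).
Proof.
intros [Hc Hi]%embedding_char HG Huw; split.
{ intros z (v & _ & ->); apply HG. }
set (p (s : Base unit_interval) := u + proj1_sig s * (w - u)).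
assert (Hp : forall s t : Base unit_interval,
  dist (p s : Base R_met) (p t) = (w - u) * dist s t).
{ intros s t; unfold p; simpl; unfold R_dist.
  rewrite <- (Rabs_pos_eq (w - u)) at 3 by lra; rewrite <- Rabs_mult; f_equal; ring. }
exists (fun s => f (p s)); split; [|split; [|split]].
- apply embedding_char; split.
  + intros s eps; destruct (Hc (p s) eps) as [d Hd].
    assert (Hd' : 0 < d / (w - u))
      by (apply Rdiv_lt_0_compat; [apply cond_pos|lra]).
    exists (mkposreal _ Hd'); intros t Ht; apply Hd; rewrite Hp.
    apply Rmult_lt_compat_l with (r := w - u) in Ht; [|lra]; cbn [pos] in Ht.
    replace ((w - u) * (d / (w - u))) with (pos d) in Ht by (field; lra); exact Ht.
  + intros s eps.
    assert (He : 0 < (w - u) * eps)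
      by (apply Rmult_lt_0_compat; [lra|apply cond_pos]).
    destruct (Hi (p s) (mkposreal _ He)) as [d Hd]; exists d; intros t Ht.
    specialize (Hd (p t) Ht); rewrite Hp in Hd; cbn [pos] in Hd.
    apply Rmult_lt_reg_l in Hd; [exact Hd|lra].
- unfold p; simpl; f_equal; ring.
- unfold p; simpl; f_equal; ring.
- intros z; split.
  + intros (v & Hv & ->).
    assert (Hs : 0 <= (v - u) / (w - u) <= 1).
    { split; [apply Rdiv_le_0_compat; lra|].
      apply Rmult_le_reg_r with (w - u); [lra|].
      unfold Rdiv; rewrite Rmult_assoc, Rinv_l; lra. }
    exists (exist (fun s : R => 0 <= s <= 1) _ Hs); unfold p; simpl.
    f_equal; field; lra.
  + intros [s <-]; exists (p s); split; [|reflexivity].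
    unfold p; destruct s as [s Hs]; simpl; split; nra.
Qed.

Lemma asymptotically_conformal_flat (Gamma : Base C_met -> Prop)
    (f : Base R_met -> Base C_met) :
  asymptotically_conformal Gamma -> embedding f -> (forall v, Gamma (f v)) ->
  forall eps, 0 < eps -> exists r, 0 < r /\
    forall u v w, u <= v <= w -> dist (f u) (f w) <= r ->
      dist (f u) (f v) + dist (f v) (f w) <= (1 + eps) * dist (f u) (f w).
Proof.
intros Hac Hemb HG eps He.
destruct (at_right_0_ex _ (Hac (mkposreal eps He))) as (r & Hr & _ & Hom).
exists r; split; [assumption|]; intros u v w Huvw Huw.
destruct (Req_dec u w) as [E|Hne].
{ replace v with u by lra; rewrite <- E, !dist_self; lra. }
assert (Hd : 0 < dist (f u) (f w)).
{ apply dist_gt_0; intros H; apply Hne; exact (embedding_inj _ _ _ Hemb _ _ H). }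
set (K z := dist (f u) (f z) + dist (f z) (f w)).
(* [omega] only sees arcs on which the maximum is attained; compactness of the parameter interval
   provides it. *)
destruct (continuity_ab_maj K u w ltac:(lra)) as (M & HM & HuMw).
{ intros y _ e0 He0; apply embedding_char in Hemb as [Hc _].
  assert (He2 : 0 < e0 / 2) by lra.
  destruct (Hc y (mkposreal _ He2)) as [d Hd'].
  exists d; split; [apply cond_pos|]; intros z [_ Hz].
  specialize (Hd' z Hz); cbn [pos] in Hd'.
  change (Rabs (K z - K y) < e0); unfold K.
  pose proof (dist_tri _ (f u) (f z) (f y)); pose proof (dist_tri _ (f u) (f y) (f z)).
  pose proof (dist_tri _ (f z) (f w) (f y)); pose proof (dist_tri _ (f y) (f w) (f z)).
  rewrite (dist_sym _ (f y) (f z)) in *; apply Rabs_def1; lra. }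
assert (Hle : Rbar_le (K M / dist (f u) (f w) - 1) (omega Gamma r)).
{ apply Lub_Rbar_correct.
  exists (f u), (f w), (fun z => exists v, u <= v <= w /\ z = f v).
  split; [apply HG|split; [apply HG|split; [now split|split]]].
  - apply segment_is_subarc; [assumption|assumption|lra].
  - split; [exists (f M); split; [now exists M|reflexivity]|].
    intros q (z & (y & Hy & ->) & ->); specialize (HM y Hy).
    fold (K y); apply Rplus_le_compat_r, Rmult_le_compat_r; [|exact HM].
    left; now apply Rinv_0_lt_compat. }
assert (Hlt := Rbar_le_lt_trans _ _ _ Hle Hom); cbn [Rbar_lt pos] in Hlt.
specialize (HM v Huvw); fold (K v).
assert (E : K M = (K M / dist (f u) (f w)) * dist (f u) (f w)) by (field; lra).
apply Rle_trans with (1 := HM); rewrite E; apply Rmult_le_compat_r; lra.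
Qed.

Lemma EWAS_mult (X Y : Metric_Space) (h : Base X -> Base Y) :
  (forall a b, h a = h b -> a = b) -> EWAS h ->
  forall eps, 0 < eps -> exists r, 0 < r /\ forall a b x,
    dist a x = dist b x -> dist a x <= r ->
    dist (h a) (h x) <= (1 + eps) * dist (h b) (h x).
Proof.
intros Hinj HE eps He.
destruct (at_right_0_ex _ (HE (mkposreal eps He))) as (r & Hr & _ & HH).
(* Two points within [r / 2] of [x] are at most [r] apart, so the diameter is at most [r]. *)
exists (r / 2); split; [lra|]; intros a b x Hab Har.
destruct (classic (b = x)) as [->|Hbx].
{ rewrite dist_self in Hab; apply dist_refl in Hab; subst a.
  rewrite !dist_self; lra. }
assert (Hb : 0 < dist b x) by now apply dist_gt_0.
assert (Hhb : 0 < dist (h b) (h x)) by (apply dist_gt_0; intros E; auto).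
assert (Hle : Rbar_le (Rmax (dist (h a) (h x) / dist (h b) (h x))
             (dist (h b) (h x) / dist (h a) (h x))) (H_eq h r)).
{ apply Lub_Rbar_correct; exists a, b, x; split; [assumption|split; [|reflexivity]].
  unfold diam3; pose proof (dist_tri _ a b x) as Ht; rewrite (dist_sym _ x b) in Ht.
  split.
  - eapply Rlt_le_trans; [|apply Rmax_r]; eapply Rlt_le_trans; [exact Hb|apply Rmax_r].
  - repeat apply Rmax_lub; lra. }
assert (Hlt := Rbar_le_lt_trans _ _ _ Hle HH); cbn in Hlt.
pose proof (Rmax_l (dist (h a) (h x) / dist (h b) (h x))
             (dist (h b) (h x) / dist (h a) (h x))).
replace (dist (h a) (h x)) with (dist (h a) (h x) / dist (h b) (h x) * dist (h b) (h x))
  by (field; lra).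
apply Rmult_le_compat_r; lra.
Qed.

(** * Relating the three conditions *)

Lemma AS_WAS (X Y : Metric_Space) (h : Base X -> Base Y) : AS h -> WAS h.
Proof. intros H; exact (H 1 Rlt_0_1). Qed.

(** For equidistant [a], [b], WAS applies in both orders and bounds both ratios. Nearby points keep
    the supremum from being empty. *)
Lemma WAS_EWAS (X Y : Metric_Space) (h : Base X -> Base Y) :
  (forall a b, h a = h b -> a = b) ->
  (forall r, 0 < r -> exists a x : Base X, 0 < dist a x <= r) ->
  WAS h -> EWAS h.
Proof.
intros Hinj Hnear HW eps.
assert (He : 0 < eps / 2) by (pose proof (cond_pos eps); lra).
destruct (HW _ He) as (d & Hd & H).
exists (mkposreal d Hd); intros r Hrd Hr.
change (Rabs (r - 0) < d) in Hrd; rewrite Rminus_0_r, Rabs_pos_eq in Hrd by lra.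
destruct (Lub_Rbar_correct (fun v => exists a b x : Base X,
    dist a x = dist b x /\ 0 < diam3 a b x <= r /\
    v = Rmax (dist (h a) (h x) / dist (h b) (h x))
             (dist (h b) (h x) / dist (h a) (h x)))) as [Hub Hlub].
fold (H_eq h r) in Hub, Hlub; split.
(* The degenerate triple [a, a, x] contributes the value 1. *)
- destruct (Hnear r Hr) as (a & x & Ha & Har).
  assert (Hax : a <> x) by (intros E; subst x; rewrite dist_self in Ha; lra).
  assert (Hh : 0 < dist (h a) (h x)) by (apply dist_gt_0; auto).
  apply Rbar_lt_le_trans with 1; [pose proof (cond_pos eps); simpl; lra|].
  apply Hub; exists a, a, x; split; [reflexivity|split].
  + unfold diam3; rewrite dist_self; split.
    * eapply Rlt_le_trans; [exact Ha|]; eapply Rle_trans; [|apply Rmax_r]; apply Rmax_r.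
    * repeat apply Rmax_lub; lra.
  + replace (dist (h a) (h x) / dist (h a) (h x)) with 1 by (field; lra).
    now rewrite Rmax_left by lra.
- apply Rbar_le_lt_trans with (1 + eps / 2);
    [|pose proof (cond_pos eps); simpl; lra].
  apply Hlub; intros v (a & b & x & Hab & [Hd0 Hdr] & ->); simpl.
  assert (Hx : a <> x /\ b <> x).
  { split; intros E; subst; rewrite dist_self in Hab.
    - symmetry in Hab; apply dist_refl in Hab; subst.
      unfold diam3 in Hd0; rewrite !dist_self, !(Rmax_left 0 0) in Hd0; lra.
    - apply dist_refl in Hab; subst.
      unfold diam3 in Hd0; rewrite !dist_self, !(Rmax_left 0 0) in Hd0; lra. }
  destruct Hx as [Hax Hbx].
  (* WAS speaks only of distinct points, so [a = b] is treated apart. *)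
  destruct (classic (a = b)) as [E|Hne].
  { subst b; assert (Hh : 0 < dist (h a) (h x)) by (apply dist_gt_0; auto).
    replace (dist (h a) (h x) / dist (h a) (h x)) with 1 by (field; lra).
    rewrite Rmax_left by lra; lra. }
  assert (Hb : 0 < dist b x) by now apply dist_gt_0.
  apply Rmax_lub; rewrite <- (Rmult_1_r (1 + eps / 2)); apply H.
  + split; auto.
  + lra.
  + rewrite Hab; apply Req_le; field; lra.
  + split; auto.
  + unfold diam3 in *; rewrite (dist_sym _ b a), (Rmax_comm (dist b x)); lra.
  + rewrite Hab; apply Req_le; field; lra.
Qed.

Lemma quasiline_near_points (Gamma : Base C_met -> Prop) : quasiline Gamma ->
  forall r, 0 < r -> exists a x : Base (subspace C_met Gamma), 0 < dist a x <= r.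
Proof.
intros (f & (Hemb & _) & Hf) r Hr.
pose proof Hemb as [Hc _]%embedding_char.
destruct (Hc 0 (mkposreal r Hr)) as [d Hd].
assert (HG : forall u, Gamma (f u)) by (intros u; apply Hf; now exists u).
exists (exist Gamma _ (HG (d / 2))), (exist Gamma _ (HG 0)).
pose proof (cond_pos d) as Hd0; split.
- change (0 < dist (f (d / 2)) (f 0)); apply dist_gt_0; intros E.
  apply (embedding_inj _ _ _ Hemb) in E; lra.
- left; apply (Hd (d / 2)); simpl; unfold R_dist.
  rewrite Rminus_0_r, Rabs_pos_eq; lra.
Qed.

(** [psi] stands for the inverse of [h] after [f]. Since the parameter comes from [Gamma2], flatness
    is read off [f] directly, while unboundedness of [Gamma1] has to be pulled back through [h]. *)
Lemma EWAS_line_pair (Gamma1 Gamma2 : Base C_met -> Prop)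
    (h : Base (subspace C_met Gamma1) -> Base (subspace C_met Gamma2))
    (f : Base R_met -> Base C_met) (psi : Base R_met -> Base (subspace C_met Gamma1)) :
  asymptotically_conformal Gamma2 -> quasisymmetric h -> uniformly_continuous_map h ->
  EWAS h -> quasisymmetric f -> continuous_map psi ->
  (forall u, proj1_sig (h (psi u)) = f u) ->
  line_pair (fun u => proj1_sig (psi u)) (fun u v => Cmod (f u - f v)%C).
Proof.
intros Hac Hh Huc HE Hf Hpsi Hhp.
assert (HG : forall u, Gamma2 (f u)) by (intros u; rewrite <- Hhp; apply proj2_sig).
assert (Hrho : forall u v, Cmod (f u - f v)%C = dist (h (psi u)) (h (psi v)))
  by (intros u v; simpl; now rewrite !Hhp).
assert (Hgap : forall u v, gap (fun u => proj1_sig (psi u)) u v = dist (psi u) (psi v))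
  by reflexivity.
assert (Hfi := embedding_inj _ _ _ (proj1 Hf)).
assert (Hpi : forall u v, proj1_sig (psi u) = proj1_sig (psi v) -> u = v).
{ intros u v E; apply Hfi; rewrite <- !Hhp; f_equal; f_equal.
  apply sub_dist_refl; rewrite E; apply dist_self. }
assert (Hqh := quasisymmetric_mult _ _ _ Hh).
(* If the distances on [Gamma1] stayed below [B], quasisymmetry of [h] would bound those on
   [Gamma2], but [f] is unbounded along [x + e * 2 ^ n]. *)
assert (Hfar : forall e, e = 1 \/ e = -1 -> forall x B, exists n,
  B <= dist (psi (x + e * 2 ^ n)) (psi x)).
{ intros e He x B.
  destruct (quasisymmetric_mult _ _ _ Hf 1) as (c & Hc & Hq).
  assert (Hpos : 0 < dist (psi (x + 1)) (psi x)).
  { apply dist_gt_0; intros E; apply (f_equal (@proj1_sig _ _)), Hpi in E; lra. }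
  destruct (Hqh (B / dist (psi (x + 1)) (psi x))) as (c' & Hc' & Hq').
  destruct (weak_quasisymmetric_unbounded f c e ltac:(lra) He Hfi) with
    (x := x) (B := c' * dist (h (psi (x + 1))) (h (psi x)) + 1) as [n Hn].
  { intros a b y Hab; apply Hq; rewrite Rmult_1_l; exact Hab. }
  exists n; apply Rnot_lt_le; intros Hlt.
  specialize (Hq' (psi (x + e * 2 ^ n)) (psi (x + 1)) (psi x)).
  rewrite Hrho in Hn.
  assert (Hle : dist (h (psi (x + e * 2 ^ n))) (h (psi x))
    <= c' * dist (h (psi (x + 1))) (h (psi x))).
  { apply Hq'; replace (B / dist (psi (x + 1)) (psi x) * dist (psi (x + 1)) (psi x))
      with B by (field; lra); lra. }
  lra. }
constructor.
- intros u v H; apply (dist_gt_0 C_met); intros E; apply H, Hfi, E.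
- intros u; apply (dist_self C_met).
- intros u v; apply Cdist_sym.
- intros u v w; apply Cdist_tri.
- exact Hpi.
- intros x eps He; destruct (Hpsi x (mkposreal eps He)) as [d Hd].
  exists d; split; [apply cond_pos|]; exact Hd.
- intros x B; destruct (Hfar 1 ltac:(now left) x B) as [n Hn].
  exists (x + 1 * 2 ^ n); split; [|exact Hn].
  pose proof (pow_lt 2 n ltac:(lra)); lra.
- intros x B; destruct (Hfar (-1) ltac:(now right) x B) as [n Hn].
  exists (x + -1 * 2 ^ n); split; [|exact Hn].
  pose proof (pow_lt 2 n ltac:(lra)); lra.
- intros t; destruct (Hqh t) as (c & Hc & Hq); exists c; split; [assumption|].
  intros a b x; rewrite !Hgap, !Hrho; apply Hq.
- intros eps He; destruct (Huc (mkposreal eps He)) as [d Hd].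
  exists d; split; [apply cond_pos|]; intros u v; rewrite Hgap, Hrho; apply Hd.
- apply (asymptotically_conformal_flat Gamma2 f Hac (proj1 Hf) HG).
- intros eps He.
  destruct (EWAS_mult _ _ h (embedding_inj _ _ _ (proj1 Hh)) HE eps He) as (r & Hr & H).
  exists r; split; [assumption|]; intros a b x; rewrite !Hgap, !Hrho; apply H.
Qed.

Theorem theorem1p4
  (Gamma1 Gamma2 : Base C_met -> Prop)
  (HGamma1 : quasiline Gamma1)
  (HGamma2 : quasiline Gamma2)
  (HGamma2ac : asymptotically_conformal Gamma2)
  (h : Base (subspace C_met Gamma1) -> Base (subspace C_met Gamma2))
  (hhomeo : homeomorphism h)
  (hqs : quasisymmetric h)
  (huc : uniformly_continuous_map h) :
  (EWAS h -> AS h) /\ (EWAS h <-> WAS h) /\ (WAS h <-> AS h).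
Proof.
assert (hinj := embedding_inj _ _ _ (proj1 hqs)).
assert (HWE : WAS h -> EWAS h)
  by exact (WAS_EWAS _ _ h hinj (quasiline_near_points _ HGamma1)).
assert (HAW : AS h -> WAS h) by exact (AS_WAS _ _ h).
(* This closes the cycle AS, WAS, EWAS, AS. *)
assert (HEA : EWAS h -> AS h); [|tauto].
intros HE t Ht eps He.
destruct HGamma2 as (f & Hf & HfG).
assert (HG : forall u, Gamma2 (f u)) by (intros u; apply HfG; now exists u).
destruct hhomeo as (_ & g & Hg & Hgh & Hhg).
set (psi u := g (exist Gamma2 (f u) (HG u))).
assert (L : line_pair (fun u => proj1_sig (psi u)) (fun u v => Cmod (f u - f v)%C)).
{ apply (EWAS_line_pair Gamma1 Gamma2 h f psi HGamma2ac hqs huc HE Hf).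
  - intros x e; destruct (Hg (exist Gamma2 (f x) (HG x)) e) as [d Hd].
    destruct (proj1 (proj1 (embedding_char _ _ f) (proj1 Hf)) x d) as [d' Hd'].
    exists d'; intros y Hy; apply Hd, Hd', Hy.
  - intros u; unfold psi; now rewrite Hhg. }
(* Every point of [Gamma1] has a parameter, so the estimate on the line covers all triples. *)
assert (Hsurj : forall a, exists u, psi u = a).
{ intros a; destruct (proj1 (HfG _) (proj2_sig (h a))) as [u Hu]; exists u.
  apply hinj; unfold psi; rewrite Hhg; apply sub_dist_refl; simpl.
  rewrite Hu; apply (dist_self C_met). }
destruct (line_pair_asymptotic _ _ L t eps Ht He) as (d & Hd & H).
exists d; split; [assumption|]; intros a b x (_ & Hax & Hbx) Hdiam Hr.
assert (Hb : 0 < dist b x) by now apply dist_gt_0.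
assert (Hhb : 0 < dist (h b) (h x)) by (apply dist_gt_0; auto).
assert (Hgb : dist b x <= d).
{ eapply Rle_trans; [|exact Hdiam]; unfold diam3.
  eapply Rle_trans; [|apply Rmax_r]; apply Rmax_r. }
assert (Hab : dist a x <= t * dist b x).
{ apply Rmult_le_compat_r with (r := dist b x) in Hr; [|lra].
  unfold Rdiv in Hr; rewrite Rmult_assoc, Rinv_l, Rmult_1_r in Hr; lra. }
apply Rmult_le_reg_r with (dist (h b) (h x)); [assumption|].
unfold Rdiv; rewrite Rmult_assoc, Rinv_l, Rmult_1_r by lra.
destruct (Hsurj a) as [ua <-], (Hsurj b) as [ub <-], (Hsurj x) as [ux <-].
unfold psi in *; rewrite !Hhg in *.
apply (H ua ub ux); [intros ->; now apply Hax|intros ->; now apply Hbx|exact Hgb|exact Hab].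
Qed.
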